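(* Let $Q$ be a finite quiver without oriented cycles with $n$ vertices and let $\beta\in\mathbb{N}^n$. Then $$\mathrm{supp}_{\mathbb{Z}}(\beta)=\mathbb{Z}^n\cap D(\beta).$$
   Context: $\Bbbk$ is an algebraically closed field, $\mathbb{N}$ includes $0$. Representations are finite dimensional over $\Bbbk$. $P(v)$ is the indecomposable projective representation at the vertex $v$, $P(\gamma)=\coprod_v P(v)^{\gamma_v}$ for $\gamma\in\mathbb{N}^n$. Euler matrix: $E_{v,v}=1$, $E_{u,v}=-(\text{number of arrows }u\to v)$ for $u\neq v$; Euler form $\langle\alpha,\beta\rangle=\alpha^tE\beta$ (also on $\mathbb{R}^n$). For $\beta\in\mathbb{N}^n$, $$D(\beta)=\{\alpha\in\mathbb{R}^n:\langle\alpha,\beta\rangle=0\}\cap\bigcap_{\beta'\hookrightarrow\beta}\{\alpha\in\mathbb{R}^n:\langle\alpha,\beta'\rangle\le 0\},$$ where $\beta'\hookrightarrow\beta$ means that the general representation of dimension vector $\beta$ (i.e. every representation in a nonempty Zariski open subset of $R(\beta)=\prod_{(u\to v)\in Q_1}\mathrm{Hom}_\Bbbk(\Bbbk^{\beta_u},\Bbbk^{\beta_v})$) has a subrepresentation of dimension vector $\beta'$. A projective decomposition of $\alpha\in\mathbb{Z}^n$ is a pair $(\gamma_0,\gamma_1)\in\mathbb{N}^n\times\mathbb{N}^n$ with $E^t\alpha=\gamma_0-\gamma_1$; the set $PD(\alpha)$ of these is directed by $(\gamma_0,\gamma_1)\le(\gamma_0+\delta,\gamma_1+\delta)$, $\delta\in\mathbb{N}^n$.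 Put $R(\gamma_0,\gamma_1)=\mathrm{Hom}_Q(P(\gamma_1),P(\gamma_0))$ with the action $(g^0,g^1)\varphi=g^0\varphi g^1$ of $\mathrm{Aut}(P(\gamma_0))\times\mathrm{Aut}(P(\gamma_1))^{op}$, with stabilization maps $R(\gamma_0,\gamma_1)\to R(\gamma_0+\delta,\gamma_1+\delta)$, $\varphi\mapsto\varphi\oplus1_{P(\delta)}$. For $g\in\mathrm{Aut}(P(\gamma))$, with diagonal blocks $g_{vv}\in\mathrm{Aut}(P(v)^{\gamma_v})\cong GL_{\gamma_v}(\Bbbk)$, and $\sigma\in\mathbb{Z}^n$, put $\chi_\sigma(g)=\prod_v\det(g_{vv})^{\sigma_v}$ (determinant of a $0\times0$ matrix is $1$). A semi-invariant of combined character $\chi_\sigma$ on $R(\gamma_0,\gamma_1)$ is a polynomial function $f$ with $f((g^0,g^1)\varphi)=\chi_\sigma(g^0)\chi_\sigma(g^1)f(\varphi)$ for all $g^0,g^1,\varphi$. $SI^{vir}(Q,\alpha)_{\chi_\sigma}$ is the space of virtual semi-invariants of combined character $\chi_\sigma$: families $(f^{(\gamma_0,\gamma_1)})_{(\gamma_0,\gamma_1)\in PD(\alpha)}$ of semi-invariants of combined character $\chi_\sigma$ on the spaces $R(\gamma_0,\gamma_1)$, compatible with restriction along the stabilization maps. For $\beta\in\mathbb{N}^n$, $\mathrm{supp}_{\mathbb{Z}}(\beta)=\{\alpha\in\mathbb{Z}^n: SI^{vir}(Q,\alpha)_{\chi_\beta}\ne0\}$. *)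

(* Defs.v *)
From HB Require Import structures.
From mathcomp Require Import all_boot all_order all_algebra.
From mathcomp Require Import classical_sets reals.
From mathcomp Require Import mpoly.

Set Implicit Arguments.
Unset Strict Implicit.
Unset Printing Implicit Defensive.

Import Order.TTheory GRing.Theory Num.Theory.
Local Open Scope ring_scope.

(* A finite quiver whose n vertices are labelled 0, ..., n-1; loops and
   multiple arrows are allowed. *)
Record quiver (n : nat) := Quiver {
  arrow : finType;
  src : arrow -> 'I_n;
  tgt : arrow -> 'I_n
}.
Arguments src {n q} a.
Arguments tgt {n q} a.

Notation dimvec n := ('I_n -> nat).

Definition addv n (d d' : dimvec n) : dimvec n := fun v => (d v + d' v)%N.

Definition cvec (R : pzRingType) n (d : dimvec n) : 'cV[R]_n :=
  \col_v (d v)%:R.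

Section Paths.
Context {n : nat} (Q : quiver n).

(* [qpath u p v]: the arrows of p, listed in the order in which they are
   travelled, form a path from u to v; [::] is the trivial path at u = v. *)
Fixpoint qpath (u : 'I_n) (p : seq (arrow Q)) (v : 'I_n) : bool :=
  if p is a :: p' then (src a == u) && qpath (tgt a) p' v else u == v.

Definition no_oriented_cycles : Prop :=
  forall (v : 'I_n) (p : seq (arrow Q)), qpath v p v -> p = [::].

Definition euler_mx : 'M[int]_n :=
  \matrix_(u, v) if u == v then 1
                 else - (#|[set a : arrow Q | (src a == u) && (tgt a == v)]|%:Z).

Definition euler_form (R : pzRingType) (x y : 'cV[R]_n) : R :=
  (x^T *m map_mx intr euler_mx *m y) ord0 ord0.

Lemma qpath_rcons u p a w :
  qpath u (rcons p a) w = qpath u p (src a) && (tgt a == w).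
Proof.
elim: p u => [|b p IH] u /=; first by rewrite eq_sym.
by rewrite IH andbA.
Qed.

(* The basis of P(gamma) at the vertex w: a copy of P(v), that is, some
   x : {v & 'I_(gamma v)}, and a path from v to w. Bounding the length of paths
   by n makes this type finite; without oriented cycles all paths are shorter
   than n, so that no path is lost. *)
Definition pbasis (g : dimvec n) (w : 'I_n) : finType :=
  {b : {v : 'I_n & 'I_(g v)} * n.-bseq (arrow Q) | qpath (tag b.1) b.2 w}.

End Paths.

Arguments euler_form {n} Q {R} x y.

Section Reps.
Context {n : nat} (Q : quiver n) (k : fieldType).

(* The representation space R(d), with k^m realised as 'rV[k]_m. Linear maps act
   on row vectors from the right, hence "first f, then g" is f *m g. *)
Definition rep (d : dimvec n) : Type :=
  forall a : arrow Q, 'M[k]_(d (src a), d (tgt a)).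

Record hom (d d' : dimvec n) (M : rep d) (N : rep d') := Hom {
  hom_at :> forall v : 'I_n, 'M[k]_(d v, d' v);
  homP : forall a : arrow Q, M a *m hom_at (tgt a) = hom_at (src a) *m N a
}.

Definition hom_id d (M : rep d) : hom M M.
Proof.
by exists (fun v => 1%:M) => a; rewrite mulmx1 mul1mx.
Defined.

(* [hom_comp g f] is g o f *)
Definition hom_comp d1 d2 d3 (M1 : rep d1) (M2 : rep d2) (M3 : rep d3)
  (g : hom M2 M3) (f : hom M1 M2) : hom M1 M3.
Proof.
by exists (fun v => f v *m g v) => a; rewrite mulmxA homP -!mulmxA homP.
Defined.

Definition hom_add d d' (M : rep d) (N : rep d') (f g : hom M N) : hom M N.
Proof.
by exists (fun v => f v + g v) => a; rewrite mulmxDr mulmxDl !homP.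
Defined.

Definition is_aut d (M : rep d) (g : hom M M) : Prop :=
  exists h : hom M M,
    (forall v, hom_comp g h v = hom_id M v) /\
    (forall v, hom_comp h g v = hom_id M v).

(* Linear coordinates on R(d), and on Hom(M, N) as a linear subspace of
   \prod_v Hom(k^(d v), k^(d' v)). *)
Definition rep_coord d (M : rep d)
    (i : 'I_#|{: {a : arrow Q & ('I_(d (src a)) * 'I_(d (tgt a)))%type}}|) : k :=
  let c := enum_val i in M (tag c) (tagged c).1 (tagged c).2.

Definition hom_coord d d' (M : rep d) (N : rep d') (f : hom M N)
    (i : 'I_#|{: {v : 'I_n & ('I_(d v) * 'I_(d' v))%type}}|) : k :=
  let c := enum_val i in f (tag c) (tagged c).1 (tagged c).2.

Definition polynomial_fun d d' (M : rep d) (N : rep d') (f : hom M N -> k) :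
    Prop :=
  exists p : {mpoly k[#|{: {v : 'I_n & ('I_(d v) * 'I_(d' v))%type}}|]},
    forall phi, f phi = p.@[hom_coord phi].

Definition zariski_open d (U : set (rep d)) : Prop :=
  exists S : set {mpoly k[#|{: {a : arrow Q &
                               ('I_(d (src a)) * 'I_(d (tgt a)))%type}}|]},
    forall M : rep d, U M <-> exists2 p, S p & p.@[rep_coord M] != 0.

(* Subspaces of k^m are row spaces of matrices. *)
Definition has_subrep d (M : rep d) (d' : dimvec n) : Prop :=
  exists U : forall v : 'I_n, 'M[k]_(d v),
    (forall v, \rank (U v) = d' v) /\
    (forall a : arrow Q, (U (src a) *m M a <= U (tgt a))%MS).

Definition general_sub (d' d : dimvec n) : Prop :=
  exists U : set (rep d),
    [/\ zariski_open U, (exists M, U M) & forall M, U M -> has_subrep M d'].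

Definition domain_D (R : realType) (beta : dimvec n) : set 'cV[R]_n :=
  ([set x | euler_form Q x (cvec R beta) = 0] `&`
   \bigcap_(beta' in [set b | general_sub b beta])
      [set x | euler_form Q x (cvec R beta') <= 0])%classic.

Definition relmx (T T' : finType) (r : T -> T' -> bool) : 'M[k]_(#|T|, #|T'|) :=
  \matrix_(i, j) (r (enum_val i) (enum_val j))%:R.

Lemma relmx_mul (T1 T2 T3 : finType) (r : T1 -> T2 -> bool)
    (s : T2 -> T3 -> bool) (t : T1 -> T3 -> bool) :
  (forall x y z, r x y -> s y z -> t x z) ->
  (forall x z, t x z -> exists y, r x y && s y z) ->
  (forall x z y y', r x y -> s y z -> r x y' -> s y' z -> y = y') ->
  relmx r *m relmx s = relmx t.
Proof.
move=> rs_t t_rs rs_uniq; apply/matrixP => i j; rewrite !mxE.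
rewrite (eq_bigr (fun l => (r (enum_val i) (enum_val l) &&
                            s (enum_val l) (enum_val j))%:R)); last first.
  move=> l _; rewrite !mxE.
  by case: (r _ _); case: (s _ _); rewrite ?mulr1 ?mulr0 ?mul0r.
case: (boolP (t _ _)) => [/t_rs[y /andP[ry sy]]|nt]; last first.
  rewrite big1 // => l _; case: andP => // -[rl sl].
  by rewrite (rs_t _ _ _ rl sl) in nt.
rewrite (bigD1 (enum_rank y)) //= enum_rankK ry sy big1 ?addr0 // => l.
case: andP => // -[rl sl] /eqP[]; apply: enum_val_inj.
by rewrite enum_rankK (rs_uniq _ _ _ _ rl sl ry sy).
Qed.

Definition pdim (g : dimvec n) : dimvec n := fun w => #|pbasis Q g w|.

(* An arrow a sends the basis element (x, p) to (x, p a). *)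
Definition proj (g : dimvec n) : rep (pdim g) := fun a =>
  relmx (fun (b : pbasis Q g (src a)) (c : pbasis Q g (tgt a)) =>
    ((val c).1 == (val b).1) &&
    (((val c).2 : seq (arrow Q)) == rcons (val b).2 a)).

(* The morphism P(g) -> P(g') sending (x, p) to the sum of the (y, p) with
   rho x y, for a relation rho between the copies of the P(v). *)
Definition label_mx (g g' : dimvec n)
    (rho : {v : 'I_n & 'I_(g v)} -> {v : 'I_n & 'I_(g' v)} -> bool) (w : 'I_n) :
    'M[k]_(pdim g w, pdim g' w) :=
  relmx (fun (b : pbasis Q g w) (c : pbasis Q g' w) =>
           rho (val b).1 (val c).1 && ((val b).2 == (val c).2)).

Lemma label_homP (g g' : dimvec n)
    (rho : {v : 'I_n & 'I_(g v)} -> {v : 'I_n & 'I_(g' v)} -> bool) :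
  (forall x y, rho x y -> tag x = tag y) ->
  forall a : arrow Q,
    proj g a *m label_mx rho (tgt a) = label_mx rho (src a) *m proj g' a.
Proof.
move=> rho_tag a.
pose t (b : pbasis Q g (src a)) (c : pbasis Q g' (tgt a)) :=
  rho (val b).1 (val c).1 &&
  (((val c).2 : seq (arrow Q)) == rcons (val b).2 a).
transitivity (relmx t).
  apply: relmx_mul.
  - move=> [[x p] Hp] [[z r] Hr] [[y q] Hq]; rewrite /t /=.
    by move=> /andP[/eqP-> /eqP rE] /andP[-> /eqP <-]; rewrite rE /=.
  - move=> [[x p] Hp] [[y q] Hq]; rewrite /t /= => /andP[rxy /eqP qE].
    have Hz : qpath (tag (x, q).1) (x, q).2 (tgt a).
      by move: Hq; rewrite /= (rho_tag _ _ rxy).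
    by exists (exist _ (x, q) Hz); rewrite /= qE rxy !eqxx.
  - move=> [[x p] Hp] [[y q] Hq] [[z r] Hr] [[z' r'] Hr'] /=.
    move=> /andP[/eqP zx _] /andP[_ /eqP rq] /andP[/eqP zx' _] /andP[_ /eqP rq'].
    by apply: val_inj; rewrite /= zx zx' rq rq'.
symmetry; apply: relmx_mul.
- move=> [[x p] Hp] [[z r] Hr] [[y q] Hq]; rewrite /t /=.
  by move=> /andP[rxz /eqP <-] /andP[/eqP-> ->]; rewrite rxz.
- move=> [[x p] Hp] [[y q] Hq]; rewrite /t /= => /andP[rxy /eqP qE].
  have Hz : qpath (tag (y, p).1) (y, p).2 (src a).
    by move: Hp; rewrite /= (rho_tag _ _ rxy).
  by exists (exist _ (y, p) Hz); rewrite /= qE rxy !eqxx.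
- move=> [[x p] Hp] [[y q] Hq] [[z r] Hr] [[z' r'] Hr'] /=.
  move=> /andP[_ /eqP pr] /andP[/eqP yz _] /andP[_ /eqP pr'] /andP[/eqP yz' _].
  by apply: val_inj; rewrite /= -yz -yz' -pr -pr'.
Qed.

Definition label_hom (g g' : dimvec n)
    (rho : {v : 'I_n & 'I_(g v)} -> {v : 'I_n & 'I_(g' v)} -> bool)
    (rho_tag : forall x y, rho x y -> tag x = tag y) :
    hom (proj g) (proj g') := Hom (label_homP rho_tag).

Section DirectSum.
Variables g d : dimvec n.

Definition lcopy (x : {v : 'I_n & 'I_(g v)}) : {v : 'I_n & 'I_(addv g d v)} :=
  Tagged (fun v => 'I_(addv g d v)) (lshift (d (tag x)) (tagged x)).
Definition rcopy (x : {v : 'I_n & 'I_(d v)}) : {v : 'I_n & 'I_(addv g d v)} :=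
  Tagged (fun v => 'I_(addv g d v)) (rshift (g (tag x)) (tagged x)).

Lemma lcopy_tag x y : y == lcopy x -> tag x = tag y.
Proof. by move/eqP->. Qed.
Lemma lcopy_tag' y x : y == lcopy x -> tag y = tag x.
Proof. by move/eqP->. Qed.
Lemma rcopy_tag x y : y == rcopy x -> tag x = tag y.
Proof. by move/eqP->. Qed.
Lemma rcopy_tag' y x : y == rcopy x -> tag y = tag x.
Proof. by move/eqP->. Qed.

Definition linj : hom (proj g) (proj (addv g d)) := label_hom lcopy_tag.
Definition lprj : hom (proj (addv g d)) (proj g) := label_hom lcopy_tag'.
Definition rinj : hom (proj d) (proj (addv g d)) := label_hom rcopy_tag.
Definition rprj : hom (proj (addv g d)) (proj d) := label_hom rcopy_tag'.

End DirectSum.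

Definition projhom (g0 g1 : dimvec n) : Type := hom (proj g1) (proj g0).

(* phi (+) 1_{P(d)}, under P(g + d) = P(g) (+) P(d) *)
Definition stab (g0 g1 d : dimvec n) (phi : projhom g0 g1) :
    projhom (addv g0 d) (addv g1 d) :=
  hom_add (hom_comp (linj g0 d) (hom_comp phi (lprj g1 d)))
          (hom_comp (rinj g0 d) (rprj g1 d)).

(* The generator e_v of the i-th copy of P(v) in P(g). *)
Definition pgen (g : dimvec n) (v : 'I_n) (i : 'I_(g v)) : pbasis Q g v :=
  exist _ (Tagged (fun v => 'I_(g v)) i, [bseq]) (eqxx v).

(* The diagonal block g_vv : P(v)^(g v) -> P(v)^(g v). As End(P(v)) = k without
   oriented cycles, it is given by the coefficients of the generators in the
   images of the generators. *)
Definition diag_block (g : dimvec n) (h : hom (proj g) (proj g)) (v : 'I_n) :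
    'M[k]_(g v) :=
  \matrix_(i, j) h v (enum_rank (pgen i)) (enum_rank (pgen j)).

Definition chi (sigma : 'cV[int]_n) (g : dimvec n)
    (h : hom (proj g) (proj g)) : k :=
  \prod_(v < n) (\det (diag_block h v)) ^ (sigma v ord0).

Definition semi_invariant (sigma : 'cV[int]_n) (g0 g1 : dimvec n)
    (f : projhom g0 g1 -> k) : Prop :=
  polynomial_fun f /\
  forall (h0 : hom (proj g0) (proj g0)) (h1 : hom (proj g1) (proj g1)),
    is_aut h0 -> is_aut h1 ->
    forall phi : projhom g0 g1,
      f (hom_comp h0 (hom_comp phi h1)) = chi sigma h0 * chi sigma h1 * f phi.

(* The boolean equation makes an element of PD(alpha) the same thing as the pair
   (gamma_0, gamma_1). *)
Record projdec (alpha : 'cV[int]_n) := ProjDec {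
  pd0 : dimvec n;
  pd1 : dimvec n;
  _ : (euler_mx Q)^T *m alpha == cvec int pd0 - cvec int pd1
}.

Lemma pd_shift_subproof (alpha : 'cV[int]_n) (x : projdec alpha)
    (d : dimvec n) :
  (euler_mx Q)^T *m alpha ==
    cvec int (addv (pd0 x) d) - cvec int (addv (pd1 x) d).
Proof.
case: x => g0 g1 /= /eqP ->; apply/eqP/matrixP => i j.
by rewrite !mxE /addv !natrD opprD addrACA subrr addr0.
Qed.

Definition pd_shift (alpha : 'cV[int]_n) (x : projdec alpha) (d : dimvec n) :
  projdec alpha := ProjDec (pd_shift_subproof x d).

Definition virtual_semi_invariant (alpha sigma : 'cV[int]_n)
    (f : forall x : projdec alpha, projhom (pd0 x) (pd1 x) -> k) : Prop :=
  (forall x, semi_invariant sigma (f x)) /\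
  (forall (x : projdec alpha) (d : dimvec n) (phi : projhom (pd0 x) (pd1 x)),
     f (pd_shift x d) (stab d phi) = f x phi).

Definition supp_int (beta : dimvec n) : set 'cV[int]_n :=
  [set alpha | exists2 f, @virtual_semi_invariant alpha (cvec int beta) f &
                 exists x phi, f x phi != 0]%classic.

End Reps.

Arguments supp_int {n} Q k beta.
Arguments domain_D {n} Q k R beta.

(* Main.v *)
From HB Require Import structures.
Require Import Defs.
From mathcomp Require Import all_boot all_order all_algebra.
From mathcomp Require Import classical_sets reals.
From mathcomp Require Import boolp fraction mpoly perm ring zify.

(** Put w = E^t alpha = gamma_0 - gamma_1, so that <alpha, d> = w.d for every
    dimension vector d, and let Hom(phi, M) : Hom(P(gamma_0), M) ->
    Hom(P(gamma_1), M) be composition with phi : P(gamma_1) -> P(gamma_0). Both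
    inclusions come down to the question whether Hom(phi, M) is invertible for
    some phi and some M of dimension vector beta.

    The answer rests on a deformation argument valid in every characteristic.
    Call two representations V, W over a field K versal if every infinitesimal
    deformation of the pair is, up to a change of basis, its derivative along a
    derivation of K; a pair with generic coordinates is versal. Differentiating
    the equation of a morphism f : V -> W gives V' f = f W' in Ext(V, W) for all
    deformations V' of V and W' of W. Taking W' = 0, and letting tr be the sum of
    the images of all f, one finds that Ext(V, tr) -> Ext(V, W) is zero, that is,
    Ext(V, W) = Ext(V, W/tr) ([trace_ext_lift]). Moreover (V, W/tr) is versal
    again ([versal_quotient]). Iterating, one reaches a subrepresentation T of W
    with Hom(V, W/T) = 0 and Ext(V, W) = Ext(V, W/T) ([torsion_quotient]), whence
    dim Hom(V, W) = <dim V, dim T>. So if <dim V, dim W> = 0 and <dim V, dim T>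
    <= 0 for all subrepresentations T of W, then Hom(V, W) = 0
    ([versal_hom_zero]). This is the case needed here of Schofield's formula for
    the general value of ext. By transposition the same holds with the quotients
    of V in place of the subrepresentations of W.

    A presentation phi enters as the representation P(gamma_0) framed by the
    images of the generators of P(gamma_1): as P(gamma_0) is rigid, this
    representation with generic phi, and a generic M, form a versal pair
    ([generic_versal]). Its Hom space is the kernel of Hom(phi, M).

    If alpha is in D(beta), the criterion gives phi and M over k for which
    Hom(phi, M) is invertible, since subrepresentations of the generic M are
    general ones ([generic_sub_general]). For this M the determinants of
    Hom(psi, M), where psi runs through all presentations of all projective
    decompositions of alpha, form a virtual semi-invariant which is not zero at
    phi ([determinant_in_support]).

    Conversely, let f be a virtual semi-invariant with f(phi) <> 0. Scalars give
    w.beta = 0. If the cokernel of phi had a quotient Y with <dim Y, beta> > 0,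
    then a one-parameter subgroup built from the standard resolution of Y would
    make f vanish at a stabilization of phi, as in the Hilbert-Mumford criterion
    ([unstable_vanishes]). The transposed criterion therefore applies, and
    Hom(phi, M) is invertible for generic phi and M ([invariant_hom_zero]). A
    general M has a subrepresentation M' of each dimension vector b that occurs
    in the definition of D(beta), and then Hom(phi, M') is injective, so that
    w.b <= 0 ([sub_dim_le]). *)

(* From here on, hom and Hom are those of quiver representations, not those of
   vector spaces. *)
Import Defs.

Set Implicit Arguments.
Unset Strict Implicit.
Unset Printing Implicit Defensive.

Import Order.TTheory GRing.Theory Num.Theory.
Local Open Scope ring_scope.

(** * Versal pairs of representations *)

Lemma dependent_choice (T : Type) (U : T -> Type)
    (P : forall x, U x -> Prop) :
  (forall x, exists y, P x y) -> exists f : forall x, U x, forall x, P x (f x).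
Proof.
by move=> h; exists (fun x => projT1 (cid (h x))) => x; apply: projT2 (cid _).
Qed.

Section Derivations.
Variable F : fieldType.
Implicit Types D : F -> F.

Definition derivation D : Prop :=
  (forall x y, D (x + y) = D x + D y) /\
  (forall x y, D (x * y) = D x * y + x * D y).

Lemma derivation0 D : derivation D -> D 0 = 0.
Proof. by case=> DD _; apply: (addrI (D 0)); rewrite -DD !addr0. Qed.

Lemma derivation_sum D (I : Type) (r : seq I) (f : I -> F) : derivation D ->
  D (\sum_(i <- r) f i) = \sum_(i <- r) D (f i).
Proof.
move=> dD; elim: r => [|i r IH]; first by rewrite !big_nil derivation0.
by rewrite !big_cons (proj1 dD) IH.
Qed.

Lemma derivation_mulmx D m n p (A : 'M[F]_(m, n)) (B : 'M_(n, p)) :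
  derivation D ->
  map_mx D (A *m B) = map_mx D A *m B + A *m map_mx D B.
Proof.
move=> dD; apply/matrixP => i j; rewrite !mxE derivation_sum // -big_split /=.
by apply: eq_bigr => l _; rewrite !mxE (proj2 dD).
Qed.

Lemma derivation_map0 D m n : derivation D ->
  map_mx D (0 : 'M[F]_(m, n)) = 0.
Proof. by move=> dD; apply/matrixP => i j; rewrite !mxE derivation0. Qed.

Lemma derivation_nat D b : derivation D -> D (b%:R) = 0.
Proof.
move=> dD; have D1 : D 1 = 0.
  by apply: (addrI (D 1)); rewrite addr0 -{3}[1]mulr1 (proj2 dD) mulr1 mul1r.
elim: b => [|b IH]; first exact: derivation0.
by rewrite -addn1 natrD (proj1 dD) IH D1 addr0.
Qed.

Lemma derivation_add D1 D2 : derivation D1 -> derivation D2 ->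
  derivation (fun x => D1 x + D2 x).
Proof.
move=> [a1 m1] [a2 m2]; split=> x y; first by rewrite a1 a2 addrACA.
by rewrite m1 m2 mulrDl mulrDr addrACA.
Qed.

End Derivations.

Section Versal.
Variables (F : fieldType) (I A : finType) (s t : A -> I).
Implicit Types d a b c : I -> nat.

(** Quivers are given here by their source and target maps, so that exchanging
    these gives the opposite quiver. *)
Definition fam d d' : Type := forall v, 'M[F]_(d v, d' v).
Definition arrfam d d' : Type := forall e : A, 'M[F]_(d (s e), d' (t e)).

(** The differential whose kernel is Hom(V, W) and whose cokernel is Ext(V, W). *)
Definition dform a b (V : arrfam a a) (W : arrfam b b) (x : fam a b) :
    arrfam a b :=
  fun e => x (s e) *m W e - V e *m x (t e).

Definition is_hom a b (V : arrfam a a) (W : arrfam b b) (x : fam a b) :=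
  forall e, V e *m x (t e) = x (s e) *m W e.

Definition hom_zero a b (V : arrfam a a) (W : arrfam b b) :=
  forall x, is_hom V W x -> forall v, x v = 0.

(** The terms [dform V V X] and [dform W W Y] are the effect of infinitesimal
    changes of basis: versality is surjectivity of the map from derivations of F
    to Ext(V, V) x Ext(W, W). *)
Definition versal a b (V : arrfam a a) (W : arrfam b b) : Prop :=
  forall (V' : arrfam a a) (W' : arrfam b b),
  exists D (X : fam a a) (Y : fam b b),
  [/\ derivation D,
      (forall e, map_mx D (V e) = V' e + dform V V X e) &
      (forall e, map_mx D (W e) = W' e + dform W W Y e)].

Section Step.
Variables (a b c : I -> nat) (V : arrfam a a) (W : arrfam b b).
Hypothesis VW : versal V W.

(** Differentiating V f = f W. The left-hand side is the obstruction to deforming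
    f along with V and W; it vanishes in Ext(V, W) because the derivative of f is
    such a deformation. *)
Lemma deform_hom D (V' : arrfam a a) (W' : arrfam b b) X Y (f : fam a b) :
  derivation D ->
  (forall e, map_mx D (V e) = V' e + dform V V X e) ->
  (forall e, map_mx D (W e) = W' e + dform W W Y e) ->
  is_hom V W f -> forall e,
  V' e *m f (t e) - f (s e) *m W' e =
  dform V W (fun v => map_mx D (f v) - X v *m f v + f v *m Y v) e.
Proof.
move=> dD DV DW homf e; rewrite /dform.
have := congr1 (map_mx D) (homf e).
rewrite !derivation_mulmx // DV DW /dform.
rewrite !(mulmxDl, mulmxDr, mulNmx, mulmxN) !mulmxA.
rewrite homf -[X _ *m V e *m _]mulmxA homf !mulmxA.
set p1 := V' e *m _; set p2 := X (s e) *m _ *m _; set p3 := V e *m X _ *m _.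
set p4 := V e *m map_mx _ _; set p5 := map_mx _ _ *m _; set p6 := f _ *m W' e.
set p7 := f _ *m Y _ *m _; set p8 := _ *m _ *m Y _.
move: p1 p2 p3 p4 p5 p6 p7 p8 => p1 p2 p3 p4 p5 p6 p7 p8 E.
apply/matrixP => i j; move/matrixP/(_ i j): E; rewrite !mxE.
by move/eqP; rewrite -subr_eq0 => /eqP E; apply: subr0_eq; rewrite -E; ring.
Qed.

Lemma dform_sum K (g : 'I_K -> fam a b) e :
  \sum_i dform V W (g i) e = dform V W (fun v => \sum_i g i v) e.
Proof. by rewrite /dform sumrB mulmx_suml mulmx_sumr. Qed.

Lemma dformD (x y : fam a b) e :
  dform V W (fun v => x v + y v) e = dform V W x e + dform V W y e.
Proof. by rewrite /dform mulmxDl mulmxDr opprD addrACA. Qed.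

Section Quotient.
Variables (N : fam b c) (S : fam c b) (Wq : arrfam c c).
Hypothesis SN : forall v, S v *m N v = 1%:M.
Hypothesis WN : forall e, W e *m N (t e) = N (s e) *m Wq e.
Variables (K : nat) (fs : 'I_K -> fam a b).
Hypothesis fs_hom : forall i, is_hom V W (fs i).
Hypothesis fs_span : forall v m (r : 'M_(m, b v)), r *m N v = 0 ->
  exists u : 'I_K -> 'M_(m, a v), r = \sum_i u i *m fs i v.
Hypothesis hom_N0 : forall f, is_hom V W f -> forall v, f v *m N v = 0.

(** Injectivity of Ext(V, W) -> Ext(V, W/tr). A class killed in Ext(V, W/tr) is
    represented by a family with values in the trace, hence is a sum of products
    of morphisms V -> W with deformations of V, and such products vanish in
    Ext(V, W) by [deform_hom]. *)
Lemma trace_ext_lift (x : arrfam a b) (y : fam a c) :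
  (forall e, x e *m N (t e) = dform V Wq y e) ->
  exists z : fam a b, forall e, x e = dform V W z e.
Proof.
move=> xN.
pose x1 : arrfam a b := fun e => x e - dform V W (fun v => y v *m S v) e.
have x1N e : x1 e *m N (t e) = 0.
  rewrite mulmxBl xN /dform mulmxBl -!mulmxA WN (mulmxA (S _)) SN mul1mx.
  by rewrite SN mulmx1 subrr.
have /dependent_choice[u uE] : forall e, exists u : 'I_K -> 'M_(a (s e), a (t e)),
    x1 e = \sum_i u i *m fs i (t e).
  by move=> e; apply: fs_span; exact: x1N.
have /dependent_choice[g gE] : forall i, exists g : fam a b,
    forall e, u e i *m fs i (t e) = dform V W g e.
  move=> i; have [D [X [Y [dD DV DW]]]] := VW (fun e => u e i) (fun e => 0).
  exists (fun v => map_mx D (fs i v) - X v *m fs i v + fs i v *m Y v) => e.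
  by rewrite -(deform_hom dD DV DW (fs_hom i)) mulmx0 subr0.
exists (fun v => \sum_i g i v + y v *m S v) => e.
rewrite dformD -dform_sum -(eq_bigr _ (fun i _ => gE i e)) -uE.
by rewrite subrK.
Qed.

(** A derivation moves tr inside W, so that the derivative of W/tr is not just the
    quotient of that of W: the error is the term with R below, the product of the
    extension class of W with the motion of tr. Correcting W' by this error costs
    nothing, because a deformation of W/tr alone, lifted to W by the section S,
    deforms every morphism V -> W within Hom(V, W) and so does not move tr. *)
Lemma versal_quotient : versal V Wq.
Proof.
move=> V' Z.
pose R e := S (s e) *m W e - Wq e *m S (t e).
have RN e : R e *m N (t e) = 0.
  by rewrite /R mulmxBl -!mulmxA WN (mulmxA (S _)) !SN mulmx1 mul1mx subrr.
(* The structure maps of the quotient move like those of W, up to R. *)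
have key D (W' : arrfam b b) Y : derivation D ->
    (forall e, map_mx D (W e) = W' e + dform W W Y e) ->
    forall e, map_mx D (Wq e) = S (s e) *m W' e *m N (t e) +
      dform Wq Wq
        (fun v => S v *m Y v *m N v - S v *m map_mx D (N v)) e +
      R e *m (map_mx D (N (t e)) - Y (t e) *m N (t e)).
  move=> dD DW e; have := congr1 (map_mx D) (WN e).
  rewrite !derivation_mulmx // => /(congr1 (mulmx (S (s e)))).
  rewrite [in RHS]mulmxDr [X in _ = _ + X]mulmxA SN mul1mx DW.
  rewrite /dform /R !(mulmxDl, mulmxDr, mulNmx, mulmxN) -!mulmxA.
  rewrite !WN !mulmxA.
  set p1 := _ *m W' e *m _; set p2 := S _ *m map_mx D (N (s e)) *m Wq e.
  set p3 := S (s e) *m Y _ *m _ *m Wq e.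
  set p4 := S _ *m W e *m Y _ *m _; set p5 := S _ *m W e *m map_mx _ _.
  set p6 := Wq e *m S _ *m _ *m N _; set p7 := Wq e *m S _ *m map_mx _ _.
  move: p1 p2 p3 p4 p5 p6 p7 => p1 p2 p3 p4 p5 p6 p7 E.
  apply/matrixP => i j; move/matrixP/(_ i j): E; rewrite !mxE.
  move/eqP; rewrite -subr_eq0 => /eqP E; apply: subr0_eq.
  by rewrite -[RHS]oppr0 -E; ring.
have [D0 [X0 [Y0 [dD0 D0V D0W]]]] :=
  VW V' (fun e => N (s e) *m Z e *m S (t e)).
pose rho e := R e *m (map_mx D0 (N (t e)) - Y0 (t e) *m N (t e)).
have [D1 [X1 [Y1 [dD1 D1V D1W]]]] :=
  VW (fun e => 0) (fun e => - (N (s e) *m rho e *m S (t e))).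
(* D1 does not move the trace, as it sends each f to a morphism, up to a change
   of basis. *)
have R0 e : R e *m (map_mx D1 (N (t e)) - Y1 (t e) *m N (t e)) = 0.
  have [u ->] := fs_span (RN e); rewrite mulmx_suml big1 // => i _.
  rewrite -mulmxA; suff -> : fs i (t e) *m
      (map_mx D1 (N (t e)) - Y1 (t e) *m N (t e)) = 0 by rewrite mulmx0.
  pose g : fam a b :=
    fun v => map_mx D1 (fs i v) - X1 v *m fs i v + fs i v *m Y1 v.
  have homg : is_hom V W g.
    move=> e'; have := deform_hom dD1 D1V D1W (fs_hom i) e'.
    rewrite mul0mx mulmxN !mulmxA (hom_N0 (fs_hom i)) !mul0mx oppr0 subrr.
    by move/esym/eqP; rewrite subr_eq0 => /eqP.
  have := hom_N0 homg (t e); rewrite /g mulmxDl mulmxBl -[X in _ - X + _]mulmxA.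
  rewrite (hom_N0 (fs_hom i)) mulmx0 subr0 -mulmxA.
  have := congr1 (map_mx D1) (hom_N0 (fs_hom i) (t e)).
  rewrite derivation_mulmx // derivation_map0 //.
  by move/eqP; rewrite addr_eq0 => /eqP->; rewrite addrC mulmxBr => /subr0_eq->;
    rewrite subrr.
exists (fun x => D0 x + D1 x).
exists (fun v => X0 v + X1 v).
exists (fun v => (S v *m Y0 v *m N v - S v *m map_mx D0 (N v)) +
                 (S v *m Y1 v *m N v - S v *m map_mx D1 (N v))).
have mapD m n (M : 'M[F]_(m, n)) :
    map_mx (fun x => D0 x + D1 x) M = map_mx D0 M + map_mx D1 M.
  by apply/matrixP => i j; rewrite !mxE.
split=> [|e|e]; first exact: derivation_add.
- rewrite mapD D0V D1V add0r -addrA; congr (_ + _).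
  by rewrite /dform mulmxDl mulmxDr opprD addrACA.
rewrite mapD (key _ _ _ dD0 D0W) (key _ _ _ dD1 D1W) R0 addr0.
have SNS u v (z : 'M[F]_(c u, c v)) : S u *m (N u *m z *m S v) *m N v = z.
  by rewrite !mulmxA SN mul1mx -mulmxA SN mulmx1.
rewrite -/(rho e) mulmxN mulNmx !SNS.
rewrite /dform !(mulmxDl _ _ (Wq e)) !(mulmxDr (Wq e)).
set p1 := _ *m Wq e; set p2 := _ *m Wq e; set p3 := _ *m Wq e.
set p4 := _ *m Wq e; set q1 := Wq e *m _; set q2 := Wq e *m _.
set q3 := Wq e *m _; set q4 := Wq e *m _.
move: p1 p2 p3 p4 q1 q2 q3 q4 (Z e) (rho e) => p1 p2 p3 p4 q1 q2 q3 q4 z r.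
by apply/matrixP => i j; rewrite !mxE; ring.
Qed.

End Quotient.
End Step.
End Versal.

Section Trace.
Variables (F : fieldType) (I : finType) (A : finType) (s t : A -> I).

Section Pair.
Variables (a b : I -> nat).
Variables (V : arrfam F s t a a) (W : arrfam F s t b b).

Definition span_of K (fs : 'I_K -> fam F a b) v : 'M[F]_(b v) :=
  (\sum_i <<fs i v>>)%MS.

(** Finitely many morphisms span the trace: choose them with the largest total
    rank. *)
Lemma trace_exists : exists K (fs : 'I_K -> fam F a b),
  (forall i, is_hom V W (fs i)) /\
  forall f, is_hom V W f -> forall v, (f v <= span_of fs v)%MS.
Proof.
pose P m := `[< exists K (fs : 'I_K -> fam F a b),
  (forall i, is_hom V W (fs i)) /\ (\sum_v \rank (span_of fs v))%N = m >].
have exP : exists m, P m.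
  pose f0 (i : 'I_0) : fam F a b := fun v => 0.
  exists (\sum_v \rank (span_of f0 v))%N.
  by apply/asboolP; exists 0%N, f0; split=> // -[].
have ubP m : P m -> (m <= (\sum_v b v)%N)%N.
  by move=> /asboolP[K [fs [_ <-]]]; apply: leq_sum => v _; apply: rank_leq_col.
have [m /asboolP[K [fs [fs_hom <-]]] maxm] := ex_maxnP exP ubP.
exists K, fs; split=> // f homf v.
pose gs (i : 'I_K.+1) := oapp fs f (unlift ord0 i).
have gsE u : span_of gs u = (<<f u>> + span_of fs u)%MS.
  rewrite /span_of big_ord_recl /gs unlift_none /=; congr (_ + _)%MS.
  by apply: eq_bigr => i _; rewrite liftK.
have sub u : (span_of fs u <= span_of gs u)%MS by rewrite gsE addsmxSr.
have : (\sum_v \rank (span_of gs v) <= \sum_v \rank (span_of fs v))%N.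
  apply: maxm; apply/asboolP; exists K.+1, gs; split=> // i.
  by rewrite /gs; case: (unlift _ _).
have lesum : (\sum_(u | u != v) \rank (span_of fs u) <=
              \sum_(u | u != v) \rank (span_of gs u))%N.
  by apply: leq_sum => u _; apply: mxrankS.
rewrite [in X in (X <= _)%N](bigD1 v) //= [in X in (_ <= X)%N](bigD1 v) //=.
move=> le_gs.
have : (\rank (span_of gs v) <= \rank (span_of fs v))%N.
  rewrite leqNgt; apply/negP => lt; move: le_gs; rewrite leqNgt.
  by rewrite -addSn leq_add.
move=> le; have [_ E] := mxrank_leqif_eq (sub v).
have : (span_of fs v == span_of gs v)%MS by rewrite -E eqn_leq mxrankS.
case/andP=> _; apply: submx_trans; rewrite gsE.
by apply: submx_trans (addsmxSl _ _); rewrite genmxE.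
Qed.

End Pair.

(** Dividing out the trace of V until no morphism from V is left. The last clause
    says that T, the kernel of N, vanishes at the vertices where V does, since T
    is filtered by sums of images of V. *)
Lemma torsion_quotient a b (V : arrfam F s t a a) (W : arrfam F s t b b) :
  versal V W ->
  exists c (N : fam F b c) (S : fam F c b) (Wq : arrfam F s t c c),
  [/\ forall v, S v *m N v = 1%:M,
      forall e, W e *m N (t e) = N (s e) *m Wq e,
      hom_zero V Wq,
      forall x : arrfam F s t a b,
        (exists y, forall e, x e *m N (t e) = dform V Wq y e) ->
        exists z, forall e, x e = dform V W z e &
      forall v, a v = 0%N -> row_free (N v)].
Proof.
have [m] := ubnP (\sum_v b v)%N; elim: m b W => // m IH b W lem VW.
have [hom0|] := pselect (hom_zero V W).
  exists b, (fun v => 1%:M), (fun v => 1%:M), W; split=> //.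
  - by move=> v; rewrite mulmx1.
  - by move=> e; rewrite mulmx1 mul1mx.
  - by move=> x [y yE]; exists y => e; rewrite -yE mulmx1.
  - by move=> v _; rewrite -row_leq_rank mxrank1.
have [K [fs [fs_hom fs_max]]] := trace_exists V W.
pose T := span_of fs.
move=> nhom0.
have {nhom0} [v0 T0] : exists v, T v != 0.
  apply/not_existsP => T0; apply: nhom0 => f homf v; apply/eqP.
  have := fs_max f homf v; rewrite -/T.
  by have /negP := T0 v; rewrite negbK => /eqP->; rewrite submx0.
pose c1 v := \rank (cokermx (T v)).
pose N1 : fam F b c1 := fun v => col_base (cokermx (T v)).
pose S1 : fam F c1 b := fun v => pinvmx (N1 v).
have SN1 v : S1 v *m N1 v = 1%:M by apply/mulVpmx/col_base_full.
have N10 v p (r : 'M_(p, b v)) : (r *m N1 v == 0) = (r <= T v)%MS.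
  rewrite submxE -[in RHS](mulmx_base (cokermx (T v))) mulmxA.
  by rewrite [RHS]mulmx_free_eq0 // row_base_free.
have hom_N0 f : is_hom V W f -> forall v, f v *m N1 v = 0.
  by move=> homf v; apply/eqP; rewrite N10; apply: fs_max.
have fs_span v p (r : 'M_(p, b v)) : r *m N1 v = 0 ->
    exists u : 'I_K -> 'M_(p, a v), r = \sum_i u i *m fs i v.
  move/eqP; rewrite N10 => /sub_sumsmxP[u ->].
  have ex i : exists w : 'M_(b v, a v), <<fs i v>>%MS = w *m fs i v.
    by apply/submxP; rewrite genmxE.
  have [w wE] := dependent_choice ex.
  exists (fun i => u i *m w i); apply: eq_bigr => i _.
  by rewrite wE mulmxA.
pose W1 : arrfam F s t c1 c1 := fun e => S1 (s e) *m W e *m N1 (t e).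
have WN1 e : W e *m N1 (t e) = N1 (s e) *m W1 e.
  suff: (1%:M - N1 (s e) *m S1 (s e)) *m (W e *m N1 (t e)) = 0.
    by rewrite mulmxBl mul1mx /W1 !mulmxA => /subr0_eq.
  have NS0 : (1%:M - N1 (s e) *m S1 (s e)) *m N1 (s e) = 0.
    by rewrite mulmxBl mul1mx -mulmxA SN1 mulmx1 subrr.
  have [u ->] := fs_span _ _ _ NS0.
  rewrite mulmx_suml big1 // => i _.
  by rewrite -mulmxA (mulmxA (fs i _)) -fs_hom -mulmxA hom_N0 // !mulmx0.
have VW1 := versal_quotient VW SN1 WN1 fs_hom fs_span hom_N0.
have lt1 : (\sum_v c1 v < m)%N.
  suff: (\sum_v c1 v < \sum_v b v)%N by move=> lt; apply: leq_trans lt lem.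
  rewrite (bigD1 v0) //= [X in (_ <= X)%N](bigD1 v0) //= -addSn.
  rewrite leq_add //; last by apply: leq_sum => v _; apply: rank_leq_row.
  rewrite /c1 mxrank_coker ltn_subrL.
  by rewrite lt0n mxrank_eq0 T0 (leq_trans _ (rank_leq_col (T v0))) // lt0n
      mxrank_eq0.
have [c [N2 [S2 [Wq [SN2 WN2 hq lift2 free2]]]]] := IH _ _ lt1 VW1.
exists c, (fun v => N1 v *m N2 v), (fun v => S2 v *m S1 v), Wq; split=> //.
- by move=> v; rewrite -mulmxA (mulmxA (S1 v)) SN1 mul1mx.
- by move=> e; rewrite mulmxA WN1 -mulmxA WN2 mulmxA.
- move=> x [y yE].
  have [z zE] := lift2 (fun e => x e *m N1 (t e))
    (ex_intro _ y (fun e => etrans (esym (mulmxA _ _ _)) (yE e))).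
  exact: (trace_ext_lift VW SN1 WN1 fs_hom fs_span zE).
- move=> v av0; have f1 : row_free (N1 v).
    have T0v : T v = 0.
      rewrite /T /span_of big1 // => i _.
      have : (<<fs i v>> <= (0 : 'M_(b v)))%MS.
        by rewrite genmxE; move: (fs i v); rewrite av0 => g; rewrite flatmx0 sub0mx.
      by rewrite submx0 => /eqP.
    have /eqP rN1 : row_full (N1 v) by apply: col_base_full.
    by rewrite /row_free rN1 /c1 mxrank_coker T0v mxrank0 subn0.
  by rewrite /row_free mxrankMfree ?free2.
Qed.

End Trace.

(** * Linear maps between families of matrices *)

Section Families.
Variable F : fieldType.

(** A product of spaces of matrices, of which both [fam] and [arrfam] are cases. *)
Definition mfam (J : finType) (m n : J -> nat) : Type :=
  forall j, 'M[F]_(m j, n j).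

(** The index set of the standard basis of [mfam]. *)
Definition fidx (J : finType) (m n : J -> nat) : finType :=
  {j : J & ('I_(m j) * 'I_(n j))%type}.

Section One.
Variables (J : finType) (m n : J -> nat).

Definition fvec (x : mfam m n) : 'rV[F]_#|fidx m n| :=
  \row_i x (tag (enum_val i)) (tagged (enum_val i)).1 (tagged (enum_val i)).2.

Definition funvec (r : 'rV[F]_#|fidx m n|) : mfam m n :=
  fun j => \matrix_(i, l) r 0 (enum_rank (Tagged _ (i, l) : fidx m n)).

Lemma fvecK : cancel fvec funvec.
Proof.
move=> x; apply: functional_extensionality_dep => j; apply/matrixP => i l.
by rewrite !mxE enum_rankK.
Qed.

Lemma funvecK : cancel funvec fvec.
Proof.
move=> r; apply/rowP => i; rewrite !mxE; congr (r 0 _).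
by apply: enum_val_inj; rewrite enum_rankK; case: (enum_val i) => j [].
Qed.

Lemma card_fidx : #|fidx m n| = (\sum_j m j * n j)%N.
Proof.
rewrite card_tagged sumnE big_map big_enum.
by apply: eq_bigr => j _; rewrite card_prod !card_ord.
Qed.

End One.

Section Linear.
Variables (J J' : finType) (m n : J -> nat) (m' n' : J' -> nat).

Definition flinear (L : mfam m n -> mfam m' n') : Prop :=
  forall c x y j, L (fun i => c *: x i + y i) j = c *: L x j + L y j.

(** The matrix of L, acting on row vectors from the right. *)
Definition fmx (L : mfam m n -> mfam m' n') : 'M[F]_(#|fidx m n|, #|fidx m' n'|) :=
  \matrix_(i, j) fvec (L (funvec (delta_mx 0 i))) 0 j.

Variable L : mfam m n -> mfam m' n'.

Lemma fmx_entry i j : fmx L i j =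
  L (funvec (delta_mx 0 i)) (tag (enum_val j)) (tagged (enum_val j)).1
    (tagged (enum_val j)).2.
Proof. by rewrite mxE /fvec mxE. Qed.

Hypothesis linL : flinear L.

Lemma fmxE x : fvec (L x) = fvec x *m fmx L.
Proof.
have lin (c : F) r r' : fvec (L (funvec (c *: r + r'))) =
    c *: fvec (L (funvec r)) + fvec (L (funvec r')).
  have -> : funvec (c *: r + r') = fun i => c *: funvec r i + funvec r' i.
    apply: functional_extensionality_dep => j; apply/matrixP => i l.
    by rewrite !mxE.
  by apply/rowP => i; rewrite !mxE linL !mxE.
rewrite -{1}(fvecK x); move: (fvec x) => r.
rewrite {1}(row_sum_delta r).
have lin0 : fvec (L (funvec 0)) = 0.
  have := lin (-1) 0 0; rewrite scaler0 addr0 scaleN1r => {1}->.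
  by rewrite addNr.
have -> : fvec (L (funvec (\sum_j r 0 j *: delta_mx 0 j))) =
          \sum_j r 0 j *: fvec (L (funvec (delta_mx 0 j))).
  by elim/big_rec2: _ => [//|i u w _ <-]; rewrite lin.
apply/rowP => j; rewrite summxE !mxE; apply: eq_bigr => i _.
by rewrite !mxE.
Qed.

Lemma fmx_free : (forall x, (forall j, L x j = 0) -> forall j, x j = 0) ->
  row_free (fmx L).
Proof.
move=> inj; rewrite -kermx_eq0; apply/eqP/row_matrixP => i; rewrite row0.
have := mulmx_ker (fmx L); move/(congr1 (row i)); rewrite row_mul row0.
rewrite -{1}(funvecK (row i _)) -fmxE => E.
have {}E j : L (funvec (row i (kermx (fmx L)))) j = 0.
  by rewrite -[L _]fvecK E; apply/matrixP => ? ?; rewrite !mxE.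
have {}E := inj _ E; rewrite -[LHS]funvecK.
by apply/rowP => j; rewrite mxE E !mxE.
Qed.

Lemma fmx_full : (forall y, exists x, L x = y) -> row_full (fmx L).
Proof.
move=> surj; apply/row_fullP.
have /dependent_choice[g gE] : forall i, exists r, r *m fmx L = row i 1%:M.
  move=> i; have [x xE] := surj (funvec (row i 1%:M)).
  by exists (fvec x); rewrite -fmxE xE funvecK.
exists (\matrix_i g i); apply/row_matrixP => i.
by rewrite row_mul rowK gE.
Qed.

Lemma flinear_inj_leq : (forall x, (forall j, L x j = 0) -> forall j, x j = 0) ->
  (\sum_j m j * n j <= \sum_j m' j * n' j)%N.
Proof.
move/fmx_free; rewrite -row_leq_rank -!card_fidx => le.
exact: leq_trans le (rank_leq_col _).
Qed.

Lemma flinear_bij_eq :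
  (forall x, (forall j, L x j = 0) -> forall j, x j = 0) ->
  (forall y, exists x, L x = y) ->
  (\sum_j m j * n j = \sum_j m' j * n' j)%N.
Proof.
by move=> /fmx_free/eqP r1 /fmx_full/eqP r2; rewrite -!card_fidx -r1 -[RHS]r2.
Qed.

Lemma flinear_inj_surj : (\sum_j m j * n j = \sum_j m' j * n' j)%N ->
  (forall x, (forall j, L x j = 0) -> forall j, x j = 0) ->
  forall y, exists x, L x = y.
Proof.
move=> eq_dim /fmx_free; rewrite -row_leq_rank => le y.
have /row_fullP[B BL] : row_full (fmx L).
  have E : #|fidx m' n'| = #|fidx m n| by rewrite !card_fidx eq_dim.
  by rewrite -col_leq_rank; apply: leq_trans (eq_leq E) le.
exists (funvec (fvec y *m B)).
by rewrite -[LHS]fvecK fmxE funvecK -mulmxA BL mulmx1 fvecK.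
Qed.

Lemma flinear_surj_inj : (\sum_j m j * n j = \sum_j m' j * n' j)%N ->
  (forall y, exists x, L x = y) ->
  forall x, (forall j, L x j = 0) -> forall j, x j = 0.
Proof.
move=> eq_dim /fmx_full; rewrite -col_leq_rank => le x Lx0 j.
have fr : row_free (fmx L).
  have E : #|fidx m n| = #|fidx m' n'| by rewrite !card_fidx eq_dim.
  by rewrite -row_leq_rank; apply: leq_trans (eq_leq E) le.
suff x0 : fvec x = 0 by rewrite -[x]fvecK x0; apply/matrixP => ? ?; rewrite !mxE.
apply: (row_free_inj fr); rewrite mul0mx -fmxE.
by apply/rowP => i; rewrite !mxE Lx0 mxE.
Qed.

End Linear.

End Families.

Section GenericHom.
Variables (F : fieldType) (I A : finType) (s t : A -> I).

(** The Euler form of the quiver, as the difference of the dimensions of the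
    source and of the target of [dform]. *)
Definition euler_pair (a b : I -> nat) : int :=
  (\sum_v a v * b v)%N%:Z - (\sum_e a (s e) * b (t e))%N%:Z.

Lemma dform_flinear a b (V : arrfam F s t a a) (W : arrfam F s t b b) :
  flinear (J' := A) (m' := fun e => a (s e)) (n' := fun e => b (t e)) (dform V W).
Proof.
move=> c x y e; rewrite /dform mulmxDl mulmxDr -scalemxAl -scalemxAr.
by rewrite opprD addrACA scalerBr.
Qed.

Lemma hom_zeroP a b (V : arrfam F s t a a) (W : arrfam F s t b b) :
  hom_zero V W <-> forall x, (forall e, dform V W x e = 0) -> forall v, x v = 0.
Proof.
split=> h x hx; apply: h => e.
  by apply/esym/subr0_eq; exact: hx.
by rewrite /dform hx subrr.
Qed.

(** With T the kernel of [torsion_quotient], Hom(V, W/T) = 0 forces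
    <dim V, dim W/T> <= 0, while the hypotheses say that it is >= 0. So
    Ext(V, W/T) vanishes too, and with it Ext(V, W) and then Hom(V, W). The
    subrepresentations are given by bases U with a right inverse, which survive
    specialization. *)
Theorem versal_hom_zero a b (V : arrfam F s t a a) (W : arrfam F s t b b) :
  versal V W -> euler_pair a b = 0 ->
  (forall d (U : fam F d b) (R : fam F b d) (B : arrfam F s t d d),
     (forall v, U v *m R v = 1%:M) ->
     (forall e, U (s e) *m W e = B e *m U (t e)) ->
     (forall v, a v = 0%N -> d v = 0%N) -> euler_pair a d <= 0) ->
  hom_zero V W.
Proof.
move=> VW chi0 sub_le0.
have [c [N [S [Wq [SN WN hom0 lift free0]]]]] := torsion_quotient VW.
pose d v := \rank (kermx (N v)).
have rN v : \rank (N v) = c v.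
  apply/eqP; rewrite eqn_leq rank_leq_col /=.
  by rewrite -[X in (X <= _)%N](mxrank1 F) -(SN v) mxrankM_maxr.
have dc v : (d v + c v = b v)%N.
  by rewrite /d mxrank_ker rN subnK // -(rN v) rank_leq_row.
pose U v := row_base (kermx (N v)).
have UN v : U v *m N v = 0.
  by apply/eqP; rewrite -sub_kermx eq_row_base.
have /dependent_choice[B BE] : forall e, exists B : 'M_(d (s e), d (t e)),
    U (s e) *m W e = B *m U (t e).
  move=> e; apply/submxP; rewrite eq_row_base sub_kermx -mulmxA WN mulmxA UN.
  by rewrite mul0mx.
have chid : euler_pair a d <= 0.
  apply: (sub_le0 d U (fun v => pinvmx (U v)) B) => //.
    by move=> v; rewrite mulmxVp ?row_base_free.
  by move=> v /free0; rewrite /d -kermx_eq0 => /eqP->; rewrite mxrank0.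
have chiD : euler_pair a b = euler_pair a d + euler_pair a c.
  have sumD (J : finType) (m n1 n2 n3 : J -> nat) :
      (forall j, n1 j + n2 j = n3 j)%N ->
      (\sum_j m j * n3 j = \sum_j m j * n1 j + \sum_j m j * n2 j)%N.
    move=> E; rewrite -big_split /=; apply: eq_bigr => j _.
    by rewrite -E mulnDr.
  rewrite /euler_pair (sumD I a d c b) // (sumD A _ (fun e => d (t e)) (fun e
      => c (t e)) (fun e => b (t e))) //.
  by rewrite !PoszD opprD addrACA.
have le_c := flinear_inj_leq (dform_flinear V Wq) ((hom_zeroP _ _).1 hom0).
have eq_c : (\sum_v a v * c v = \sum_e a (s e) * c (t e))%N.
  apply/eqP; rewrite eqn_leq le_c /=.
  have : 0 <= euler_pair a c by rewrite -chi0 chiD; lia.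
  by rewrite /euler_pair subr_ge0.
have surj := flinear_inj_surj (dform_flinear V Wq) eq_c ((hom_zeroP _ _).1 hom0).
apply/hom_zeroP; apply: (flinear_surj_inj (dform_flinear V W)).
  by apply/eqP; rewrite -eqz_nat -subr_eq0; apply/eqP.
move=> x; have [|z zE] := lift x; last by exists z; apply:
    functional_extensionality_dep.
have [y yE] := surj (fun e => x e *m N (t e)).
by exists y => e; rewrite yE.
Qed.

End GenericHom.

(** * Function fields: derivations and specialization *)

Section NonvanishingPoint.
Variable k : closedFieldType.
Local Notation widen := (widen_ord (leqnSn _)).

Lemma muni_neq0 n (p : {mpoly k[n.+1]}) : p != 0 -> muni p != 0.
Proof.
apply: contra => /eqP p0; apply/eqP/mpolyP => m.
have : (muni p)`_(m ord_max)@_[multinom (m (widen i)) | i < n] = 0.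
  by rewrite p0 coef0 mcoeff0.
rewrite mcoeff0 muniE coef_sum raddf_sum /=.
case: (boolP (m \in msupp p)) => [mp|]; last first.
  by rewrite -mcoeff_eq0 => /eqP-> _.
rewrite (bigD1_seq m) //= big1_seq ?addr0 => [|m' /andP[neq _]].
  by rewrite coefZ coefXn eqxx mulr1 mcoeffZ mcoeffX eqxx mulr1.
rewrite coefZ coefXn; case: (m ord_max =P m' ord_max) => [E|_]; last first.
  by rewrite mulr0 mcoeff0.
rewrite mulr1 mcoeffZ mcoeffX; case: eqP => [E'|_]; last by rewrite mulr0.
case/eqP: neq; apply/mnmP => i.
have [->//|[j ->]] : i = ord_max \/ exists j : 'I_n, i = widen j.
  case: (unliftP ord_max i) => [j ->|->]; [right|by left].
  by exists j; apply: val_inj; rewrite /= /bump leqNgt ltn_ord.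
by move/mnmP/(_ j): E'; rewrite !mnmE.
Qed.

(** An algebraically closed field is infinite; the variables are chosen one at a
    time, starting with the last. *)
Lemma mpoly_nonzero_at n (p : {mpoly k[n]}) : p != 0 -> exists v, p.@[v] != 0.
Proof.
elim: n p => [|n IH] p p0.
  exists (fun _ => 0); rewrite mevalE.
  have [m mp] : exists m, m \in msupp p.
    by move: p0; rewrite -msupp_eq0; case: (msupp p) => // m s _; exists m;
      rewrite mem_head.
  rewrite (bigD1_seq m) //= big_ord0 mulr1 big1_seq ?addr0 -?mcoeff_msupp //.
  by move=> m' /andP[/eqP[]]; apply/mnmP => -[].
have := muni_neq0 p0.
have [j cj] : exists j, (muni p)`_j != 0.
  exists (size (muni p)).-1; rewrite -/(lead_coef _) lead_coef_eq0.
  exact: muni_neq0.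
have [v cv] := IH _ cj; move=> _.
have : map_poly (meval v) (muni p) != 0.
  apply: contra cv => /eqP/(congr1 (fun q : {poly k} => q`_j)).
  by rewrite coef_map coef0 /= => ->.
case/closed_nonrootP => t; rewrite /root => nz.
exists (fun i => oapp v t (unlift ord_max i)).
apply: contra nz => /eqP <-; apply/eqP.
rewrite muniE mevalE rmorph_sum /= horner_sum; apply: eq_bigr => m _.
rewrite !(linearZ, map_polyZ) /= !hornerE map_polyXn hornerXn mevalZ mevalX.
rewrite big_ord_recr /= unlift_none /= mulrA; congr (_ * _ * _).
apply: eq_bigr => i _; rewrite mnmE; congr (_ ^+ _).
have -> : widen_ord (leqnSn n) i = lift ord_max i.
  by apply: val_inj; rewrite /= /bump leqNgt ltn_ord.
by rewrite liftK.
Qed.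

End NonvanishingPoint.

Section QuotientRule.
Variable F : fieldType.
Implicit Types n d m e : F.

Lemma quotient_rule_unique n d n' d' Dn Dd Dn' Dd' : d != 0 -> d' != 0 ->
  n * d' = n' * d -> Dn * d' + n * Dd' = Dn' * d + n' * Dd ->
  (Dn' * d' - n' * Dd') / d' ^+ 2 = (Dn * d - n * Dd) / d ^+ 2.
Proof.
move=> d0 d'0 E DE.
have -> : Dn' = (Dn * d' + n * Dd' - n' * Dd) / d.
  by apply: (canRL (mulfK d0)); rewrite DE; ring.
have -> : n = n' * d / d' by apply: (canRL (mulfK d'0)).
by field; rewrite d0 d'0.
Qed.

Lemma quotient_rule_add n d m e Dn Dd Dm De : d != 0 -> e != 0 ->
  ((Dn * e + n * De + (Dm * d + m * Dd)) * (d * e)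
    - (n * e + m * d) * (Dd * e + d * De)) / (d * e) ^+ 2 =
  (Dn * d - n * Dd) / d ^+ 2 + (Dm * e - m * De) / e ^+ 2.
Proof. by move=> d0 e0; field; rewrite d0 e0. Qed.

Lemma quotient_rule_mul n d m e Dn Dd Dm De : d != 0 -> e != 0 ->
  ((Dn * m + n * Dm) * (d * e) - (n * m) * (Dd * e + d * De)) / (d * e) ^+ 2 =
  (Dn * d - n * Dd) / d ^+ 2 * (m / e) + n / d * ((Dm * e - m * De) / e ^+ 2).
Proof. by move=> d0 e0; field; rewrite d0 e0. Qed.

Lemma div_cross n d m e : d != 0 -> e != 0 -> n / d = m / e ->
  n * e = m * d.
Proof. by move=> d0 e0 /eqP; rewrite eqr_div // => /eqP. Qed.

Lemma cross_div n d m e : d != 0 -> e != 0 -> n * e = m * d ->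
  n / d = m / e.
Proof. by move=> d0 e0 E; apply/eqP; rewrite eqr_div // E. Qed.

End QuotientRule.

Section FractionDerivation.
Variable R : idomainType.
Notation K := {fraction R}.

Lemma fractionP (x : K) : exists n d : R, d != 0 /\ x = tofrac n / tofrac d.
Proof.
elim/quotW: x => r; exists (\n_r), (\d_r).
have d0 : \d_r != 0 by apply: denom_ratioP.
split=> //; apply: (canRL (mulfK _)); first by rewrite tofrac_eq0.
unlock FracField.tofrac; rewrite -[LHS]FracField.pi_mul.
apply/eqmodP; rewrite /= FracField.equivfE /FracField.mulf.
by rewrite !numden_Ratio ?mulf_neq0 ?oner_neq0 //= !mulr1 mulrC.
Qed.

Variable D0 : R -> K.
Hypothesis D0D : forall p q, D0 (p + q) = D0 p + D0 q.
Hypothesis D0M : forall p q, D0 (p * q) = D0 p * tofrac q + tofrac p * D0 q.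

(** The extension of D0 to fractions by the quotient rule, for some choice of
    numerator and denominator. *)
Definition fracD (x : K) : K :=
  let n := xget 0 [set n : R | exists2 d : R, d != 0 & x = tofrac n / tofrac
      d]%classic in
  let d := xget 0 [set d : R | d != 0 /\ x = tofrac n / tofrac d]%classic in
  (D0 n * tofrac d - tofrac n * D0 d) / tofrac d ^+ 2.

Lemma fracDE n d : d != 0 ->
  fracD (tofrac n / tofrac d) =
  (D0 n * tofrac d - tofrac n * D0 d) / tofrac d ^+ 2.
Proof.
move=> d0; rewrite /fracD; set x := tofrac n / tofrac d.
set n' := xget _ _.
have [d1 d10 xE1] : exists2 d : R, d != 0 & x = tofrac n' / tofrac d.
  have [m [e [e0 xE]]] := fractionP x.
  by apply: (xgetPex 0 (P := [set n : R | exists2 d : R, d != 0 & x = tofrac n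
      / tofrac d]%classic)); exists m, e.
set d' := xget _ _.
have [d'0 xE] : d' != 0 /\ x = tofrac n' / tofrac d'.
  by apply: (xgetPex 0 (P := [set d : R | d != 0 /\ x = tofrac n' / tofrac
      d]%classic)); exists d1.
have td : tofrac d != 0 by rewrite tofrac_eq0.
have td' : tofrac d' != 0 by rewrite tofrac_eq0.
have E : n * d' = n' * d.
  apply/eqP; rewrite -tofrac_eq !tofracM; apply/eqP.
  by have := xE; rewrite /x => /eqP; rewrite eqr_div // => /eqP.
have := congr1 D0 E; rewrite !D0M => DE.
have {}E : tofrac n * tofrac d' = tofrac n' * tofrac d by rewrite -!tofracM E.
exact: quotient_rule_unique.
Qed.

Lemma fracD_derivation : derivation fracD.
Proof.
split=> x y.
  have [n [d [d0 ->]]] := fractionP x; have [m [e [e0 ->]]] := fractionP y.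
  have td : tofrac d != 0 by rewrite tofrac_eq0.
  have te : tofrac e != 0 by rewrite tofrac_eq0.
  have -> : tofrac n / tofrac d + tofrac m / tofrac e =
            tofrac (n * e + m * d) / tofrac (d * e).
    by rewrite tofracD !tofracM addf_div.
  rewrite !fracDE ?mulf_neq0 // D0D !D0M tofracD !tofracM.
  exact: quotient_rule_add.
have [n [d [d0 ->]]] := fractionP x; have [m [e [e0 ->]]] := fractionP y.
have td : tofrac d != 0 by rewrite tofrac_eq0.
have te : tofrac e != 0 by rewrite tofrac_eq0.
have -> : tofrac n / tofrac d * (tofrac m / tofrac e) =
          tofrac (n * m) / tofrac (d * e).
  by rewrite !tofracM mulf_div.
rewrite !fracDE ?mulf_neq0 // !D0M !tofracM.
exact: quotient_rule_mul.
Qed.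

Lemma fracD_tofrac p : fracD (tofrac p) = D0 p.
Proof.
have D01 : D0 1 = 0.
  by apply: (addrI (D0 1)); rewrite addr0 -{3}[1]mulr1 D0M tofrac1 mulr1 mul1r.
rewrite -[tofrac p]divr1 -(tofrac1 R) fracDE ?oner_neq0 //.
by rewrite D01 tofrac1 mulr0 subr0 expr1n divr1 mulr1.
Qed.

End FractionDerivation.

Section GenericDerivation.
Variables (k : fieldType) (N : nat).
Notation K := {fraction {mpoly k[N]}}.

(** A combination of the partial derivatives with coefficients c. *)
Lemma exists_derivation (c : 'I_N -> K) :
  exists D : K -> K, derivation D /\ forall i, D (tofrac 'X_i) = c i.
Proof.
pose D0 (p : {mpoly k[N]}) : K := \sum_i c i * tofrac p^`M(i).
have D0D p q : D0 (p + q) = D0 p + D0 q.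
  rewrite /D0 -big_split /=; apply: eq_bigr => i _.
  by rewrite linearD tofracD mulrDr.
have D0M p q : D0 (p * q) = D0 p * tofrac q + tofrac p * D0 q.
  rewrite /D0 mulr_suml mulr_sumr -big_split /=; apply: eq_bigr => i _.
  by rewrite mderivM tofracD !tofracM mulrDr mulrA [in RHS]mulrCA.
exists (fracD D0); split; first exact: fracD_derivation.
move=> i; rewrite (fracD_tofrac D0M) /D0 (bigD1 i) //= big1 => [|j ji].
  rewrite mderivX mnm1E eqxx scale1r addr0.
  rewrite (_ : (U_(i) - U_(i))%MM = 0%MM) ?mpolyX0 ?tofrac1 ?mulr1 //.
  by apply/mnmP => j; rewrite mnmBE mnm0E subnn.
by rewrite mderivX mnm1E eq_sym (negPf ji) scale0r tofrac0 mulr0.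
Qed.

End GenericDerivation.

Section Values.
Variables (R : idomainType) (k : fieldType) (ev : {rmorphism R -> k}).
Notation K := {fraction R}.

(** The value at ev of a fraction with a denominator that does not vanish there.
    As a relation it needs no choice of such a denominator, and identities between
    fractions carry over to their values by [has_value_uniq]. *)
Definition has_value (y : K) (c : k) : Prop :=
  exists n d : R, [/\ ev d != 0, y = tofrac n / tofrac d & c = ev n / ev d].

Lemma tofrac_neq0 (d : R) : ev d != 0 -> tofrac d != 0 :> K.
Proof. by rewrite tofrac_eq0; apply: contra => /eqP->; rewrite rmorph0. Qed.

Lemma has_value_uniq y c c' : has_value y c -> has_value y c' -> c = c'.
Proof.
move=> [n [d [d0 -> ->]]] [m [e [e0 E ->]]].
have := div_cross (tofrac_neq0 d0) (tofrac_neq0 e0) E.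
rewrite -2!tofracM => /eqP; rewrite tofrac_eq => /eqP {}E.
by apply: cross_div => //; rewrite -!rmorphM E.
Qed.

Lemma has_value_tofrac p : has_value (tofrac p) (ev p).
Proof. by exists p, 1; rewrite tofrac1 rmorph1 !divr1 oner_neq0. Qed.

Lemma has_value_nat b : has_value b%:R b%:R.
Proof. by have := has_value_tofrac b%:R; rewrite !rmorph_nat. Qed.

Lemma has_valueD y c y' c' : has_value y c -> has_value y' c' ->
  has_value (y + y') (c + c').
Proof.
move=> [n [d [d0 -> ->]]] [m [e [e0 -> ->]]]; exists (n * e + m * d), (d * e).
have [td te] := (tofrac_neq0 d0, tofrac_neq0 e0).
rewrite rmorphM mulf_neq0 //; split=> //.
  by rewrite tofracD !tofracM addf_div.
by rewrite rmorphD !rmorphM addf_div.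
Qed.

Lemma has_valueM y c y' c' : has_value y c -> has_value y' c' ->
  has_value (y * y') (c * c').
Proof.
move=> [n [d [d0 -> ->]]] [m [e [e0 -> ->]]]; exists (n * m), (d * e).
by rewrite !rmorphM !mulf_div mulf_neq0.
Qed.

Lemma has_valueN y c : has_value y c -> has_value (- y) (- c).
Proof.
move=> [n [d [d0 -> ->]]]; exists (- n), d.
by rewrite !rmorphN !mulNr.
Qed.

Definition has_valuemx m n (M : 'M[K]_(m, n)) (P : 'M[k]_(m, n)) : Prop :=
  forall i j, has_value (M i j) (P i j).

Lemma has_valuemx_uniq m n (M : 'M[K]_(m, n)) P P' :
  has_valuemx M P -> has_valuemx M P' -> P = P'.
Proof.
by move=> h h'; apply/matrixP => i j; apply: has_value_uniq (h i j) (h' i j).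
Qed.

Lemma has_valuemx_mul m n p (M : 'M[K]_(m, n)) P (M' : 'M_(n, p)) P' :
  has_valuemx M P -> has_valuemx M' P' -> has_valuemx (M *m M') (P *m P').
Proof.
move=> h h' i j; rewrite !mxE.
elim/big_rec2: _ => [|l y c _ IH]; first exact: (has_value_nat 0).
exact: has_valueD (has_valueM _ _) IH.
Qed.

Lemma has_valuemx_sub m n (M : 'M[K]_(m, n)) P M' P' :
  has_valuemx M P -> has_valuemx M' P' -> has_valuemx (M - M') (P - P').
Proof. by move=> h h' i j; rewrite !mxE; apply/has_valueD/has_valueN. Qed.

Lemma has_valuemx1 n : has_valuemx (1%:M : 'M_n) 1%:M.
Proof. by move=> i j; rewrite !mxE; apply: has_value_nat. Qed.

Lemma has_valuemx_tr m n (M : 'M[K]_(m, n)) P :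
  has_valuemx M P -> has_valuemx M^T P^T.
Proof. by move=> h i j; rewrite !mxE. Qed.

End Values.

(** The product of the denominators of all entries can serve as q. *)
Lemma specialize_family (R : idomainType) (J : finType) (m n : J -> nat)
    (Y : mfam {fraction R} m n) :
  exists2 q : R, q != 0 &
    forall (k : fieldType) (ev : {rmorphism R -> k}), ev q != 0 ->
    exists y : mfam k m n, forall j, has_valuemx ev (Y j) (y j).
Proof.
pose entry (c : fidx m n) := Y (tag c) (tagged c).1 (tagged c).2.
have /dependent_choice[den denP] : forall c, exists d : R,
    d != 0 /\ exists n, entry c = tofrac n / tofrac d.
  move=> c; have [a [d [d0 E]]] := fractionP (entry c).
  by exists d; split=> //; exists a.
exists (\prod_c den c).
  by apply/prodf_neq0 => c _; case: (denP c).
move=> k ev; rewrite rmorph_prod /= => /prodf_neq0 dx.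
have /dependent_choice[num numP] := fun c => (denP c).2.
exists (fun j => \matrix_(i, l) (ev (num (Tagged _ (i, l) : fidx m n)) /
                                 ev (den (Tagged _ (i, l) : fidx m n)))).
move=> j i l; rewrite mxE; set c : fidx m n := Tagged _ _.
by exists (num c), (den c); rewrite dx //; split=> //; rewrite -numP.
Qed.

(** * Morphisms from projective representations *)

Section Acyclic.
Variables (n : nat) (Q : quiver n).
Hypothesis acyclic : no_oriented_cycles Q.

Definition adjacent : rel 'I_n :=
  fun u v => [exists a : arrow Q, (src a == u) && (tgt a == v)].

(** It increases strictly along arrows and lies between 1 and n. *)
Definition height v := #|[pred u | connect adjacent u v]|.

Lemma connect_qpath u v : connect adjacent u v -> exists p, qpath (Q := Q) u p v.
Proof.
case/connectP=> s; elim: s u => [|w s IH] u /=; first by move=> _ ->; exists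
    [::] => /=.
case/andP=> /existsP[a /andP[/eqP sa /eqP ta]] /IH h /h[p hp].
by exists (a :: p); rewrite /= sa eqxx ta.
Qed.

Lemma height_arrow (a : arrow Q) : (height (src a) < height (tgt a))%N.
Proof.
have ea : connect adjacent (src a) (tgt a).
  by apply: connect1; apply/existsP; exists a; rewrite !eqxx.
apply: proper_card; apply/properP; split.
  by apply/fintype.subsetP => u; rewrite !inE => h; apply: connect_trans h ea.
exists (tgt a); rewrite !inE ?connect0 //; apply/negP => /connect_qpath[p hp].
have : qpath (src a) (a :: p) (src a) by rewrite /= eqxx.
by move/acyclic.
Qed.

Lemma height_qpath u p v : qpath (Q := Q) u p v -> (height u + size p <= height v)%N.
Proof.
elim: p u => [|a p IH] u /=; first by move/eqP->; rewrite addn0.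
case/andP=> /eqP <- /IH; apply: leq_trans.
by rewrite addnS -addSn leq_add2r height_arrow.
Qed.

(** So the bound n on the length of the paths in [pbasis] excludes none. *)
Lemma qpath_size u p v : qpath (Q := Q) u p v -> (size p < n)%N.
Proof.
move/height_qpath => le; apply: leq_trans (leq_trans le _).
  by rewrite -[X in (X < _)%N]add0n ltn_add2r; apply/card_gt0P; exists u; rewrite inE.
by rewrite -[X in (_ <= X)%N](card_ord n) max_card.
Qed.

Lemma pext_subproof g (a : arrow Q) (b : pbasis Q g (src a)) :
  exists c : pbasis Q g (tgt a),
    (val c).1 = (val b).1 /\ (val c).2 = rcons (val b).2 a :> seq _.
Proof.
case: b => -[x p] /= hp.
have hpa : qpath (tag x) (rcons p a) (tgt a) by rewrite qpath_rcons hp /=.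
have sz : (size (rcons p a) <= n)%N by apply/ltnW/(qpath_size hpa).
by exists (exist _ (x, Bseq sz) hpa).
Qed.

(** The basis element b followed by the arrow a. *)
Definition pext g (a : arrow Q) (b : pbasis Q g (src a)) : pbasis Q g (tgt a) :=
  projT1 (cid (pext_subproof b)).

Lemma pextE g (a : arrow Q) (b : pbasis Q g (src a)) :
  (val (pext b)).1 = (val b).1 /\ (val (pext b)).2 = rcons (val b).2 a :> seq _.
Proof. exact: (projT2 (cid (pext_subproof b))). Qed.

Lemma pbasis_eq g w (b c : pbasis Q g w) : (val b).1 = (val c).1 ->
  (val b).2 = (val c).2 :> seq _ -> b = c.
Proof.
move=> e1 e2; apply: val_inj; rewrite [val b]surjective_pairing e1.
by rewrite [RHS]surjective_pairing; congr (_, _); apply: val_inj.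
Qed.

Lemma pbasis_ind g (P : forall w, pbasis Q g w -> Prop) :
  (forall v i, P v (pgen Q i)) ->
  (forall a (b : pbasis Q g (src a)), P (src a) b -> P (tgt a) (pext b)) ->
  forall w b, P w b.
Proof.
move=> Pgen Pext w b.
have [m] := ubnP (size (val b).2); elim: m w b => // m IH w b.
have [p] : exists p, (val b).2 = p :> seq _ by exists (val b).2.
case/lastP: p => [|p a] pE lt.
  case: b pE lt => -[[v i] p] /= hp pE _.
  have vw : v = w by move: hp; rewrite pE /= => /eqP.
  subst w; rewrite (_ : exist _ _ _ = pgen Q i) //.
  exact: pbasis_eq.
have hb := valP b; rewrite /= pE qpath_rcons in hb.
case/andP: hb => hp /eqP ta; subst w.
have sz : (size p <= n)%N by apply/ltnW/(qpath_size hp).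
have -> : b = pext (exist _ ((val b).1, Bseq sz) hp : pbasis Q g (src a)).
  have [e1 e2] := pextE (exist _ ((val b).1, Bseq sz) hp : pbasis Q g (src a)).
  by apply: pbasis_eq; rewrite ?e1 ?e2.
by apply/Pext/IH; rewrite /=; move: lt; rewrite pE size_rcons.
Qed.

Section Extension.
Variable F : fieldType.

Lemma proj_row g (a : arrow Q) (b : pbasis Q g (src a)) m
    (M : 'M[F]_(pdim Q g (tgt a), m)) :
  row (enum_rank b) (proj F g a *m M) = row (enum_rank (pext b)) M.
Proof.
rewrite row_mul [RHS]rowE; congr (_ *m _); apply/rowP => j.
rewrite !mxE enum_rankK eqxx /=; congr ((nat_of_bool _)%:R).
have [e1 e2] := pextE b.
apply/andP/eqP => [[/eqP c1 /eqP c2]|->].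
  by apply: enum_val_inj; rewrite enum_rankK; apply: pbasis_eq; rewrite ?e1 ?e2.
by rewrite enum_rankK e1 e2.
Qed.

Section Target.
Variables (g d : dimvec n) (N : rep Q F d).
Implicit Types x : fam F (pdim Q g) d.

Definition gens x : fam F g d :=
  fun v => rowsub (fun i => enum_rank (pgen Q i)) (x v).

Lemma row_gens x v i : row i (gens x v) = row (enum_rank (pgen Q i)) (x v).
Proof. exact: row_rowsub. Qed.

Lemma rows_eq x y : (forall w (b : pbasis Q g w),
  row (enum_rank b) (x w) = row (enum_rank b) (y w)) -> x = y.
Proof.
move=> E; apply: functional_extensionality_dep => w; apply/row_matrixP => i.
by rewrite -(enum_valK i) E.
Qed.

Lemma hom_gens0 x : is_hom (proj F g) N x -> (forall v, gens x v = 0) ->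
  forall v, x v = 0.
Proof.
move=> hx x0; suff -> : x = fun v => 0 by [].
apply: rows_eq => w; move: w; apply: pbasis_ind => [v i|a b IH].
  by rewrite -row_gens x0 !row0.
by rewrite row0 -proj_row hx row_mul IH row0 mul0mx.
Qed.

(** The identity of k^(d u) if u and v are equal, and 0 otherwise: it replaces
    a cast along u = v. *)
Definition transport u v : 'M[F]_(d u, d v) :=
  \matrix_(i, j) ((u == v) && (i == j :> nat))%:R.

Lemma transport_id v : transport v v = 1%:M.
Proof. by apply/matrixP => i j; rewrite !mxE eqxx. Qed.

(** P(g) is free on its generators, and an inhomogeneous term c in the equation of
    a morphism does no harm: values on longer paths are determined recursively by
    the last arrow. For c = 0 this is the universal property of P(g); for general
    c it gives Ext(P(g), N) = 0. *)
Lemma extend_gens (x0 : fam F g d) (c : arrfam F src tgt (pdim Q g) d) :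
  exists2 x, (forall v, gens x v = x0 v) &
    forall a, proj F g a *m x (tgt a) = x (src a) *m N a - c a.
Proof.
(* The row of c a at the basis element (y, p); zero if there is none. *)
pose crow (a : arrow Q) (y : {v : 'I_n & 'I_(g v)}) (p : seq (arrow Q)) :
    'rV[F]_(d (tgt a)) :=
  \sum_(b : pbasis Q g (src a) | ((val b).1 == y) && ((val b).2 == p :> seq _))
    row (enum_rank b) (c a).
(* The value at the basis element (y, rev p). *)
pose step (y : {v : 'I_n & 'I_(g v)}) :=
  fix step (p : seq (arrow Q)) (w : 'I_n) {struct p} : 'rV[F]_(d w) :=
  if p is a :: p' then
    (step p' (src a) *m N a - crow a y (rev p')) *m transport (tgt a) w
  else row (tagged y) (x0 (tag y)) *m transport (tag y) w.
pose row_at w (b : pbasis Q g w) := step (val b).1 (rev (val b).2) w.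
exists (fun w => \matrix_(i < pdim Q g w) row_at w (enum_val i)).
  move=> v; apply/row_matrixP => i; rewrite row_gens rowK enum_rankK /row_at /=.
  by rewrite transport_id mulmx1.
move=> a; apply/row_matrixP => j; rewrite -(enum_valK j).
set b := enum_val j; rewrite proj_row rowK enum_rankK /row_at.
have [-> ->] := pextE b; rewrite rev_rcons /= transport_id mulmx1 revK.
rewrite linearB /= row_mul rowK enum_rankK; congr (_ - _).
rewrite /crow (bigD1 b) /=; last by rewrite !eqxx.
rewrite big1 ?addr0 // => b' /andP[/andP[/eqP e1 /eqP e2] /eqP[]].
exact: pbasis_eq.
Qed.

End Target.
End Extension.
End Acyclic.

(** * Framed representations *)

Section Transpose.
Variables (F : fieldType) (I A : finType) (s t : A -> I).

(** Duality: transposing exchanges V and W and reverses the arrows. *)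
Lemma versal_tr (a b : I -> nat) (V : arrfam F s t a a) (W : arrfam F s t b b) :
  versal V W ->
  @versal F I A t s b a (fun e => (W e)^T) (fun e => (V e)^T).
Proof.
move=> VW W' V'.
have [D [X [Y [dD DV DW]]]] := VW (fun e => (V' e)^T) (fun e => (W' e)^T).
have dformT (c : I -> nat) (Z : arrfam F s t c c) (x : fam F c c) e :
    (dform Z Z x e)^T = @dform F I A t s _ _ (fun e => (Z e)^T) (fun e => (Z e)^T)
       (fun v => - (x v)^T) e.
  by rewrite /dform linearB /= !trmx_mul mulNmx mulmxN opprK addrC.
exists D, (fun v => - (Y v)^T), (fun v => - (X v)^T); split=> // e.
  by rewrite -map_trmx DW linearD /= trmxK dformT.
by rewrite -map_trmx DV linearD /= trmxK dformT.
Qed.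

Lemma hom_zero_tr (a b : I -> nat) (V : arrfam F s t a a) (W : arrfam F s t b b) :
  @hom_zero F I A t s b a (fun e => (W e)^T) (fun e => (V e)^T) -> hom_zero V W.
Proof.
move=> h x hx v; apply: trmx_inj; rewrite trmx0.
by apply: (h (fun v => (x v)^T)) => e; rewrite -!trmx_mul hx.
Qed.

End Transpose.

Section Specialization.
Variables (R : idomainType) (I A : finType) (s t : A -> I).
Notation K := {fraction R}.

(** Hom(V, W) = 0 is expressed by a right inverse of the matrix of [dform], which
    specializes. *)
Lemma hom_zero_specialize a b (V : arrfam K s t a a) (W : arrfam K s t b b) :
  hom_zero V W ->
  exists2 q : R, q != 0 &
  forall (k : fieldType) (ev : {rmorphism R -> k})
    (V' : arrfam k s t a a) (W' : arrfam k s t b b), ev q != 0 ->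
    (forall e, has_valuemx ev (V e) (V' e)) ->
    (forall e, has_valuemx ev (W e) (W' e)) -> hom_zero V' W'.
Proof.
move=> /hom_zeroP h.
have /row_freeP[B LB] := fmx_free (dform_flinear V W) h.
have [q q0 qP] := specialize_family (J := unit) (fun=> B).
exists q => // k ev V' W' evq VV' WW'; apply/hom_zeroP.
have [B' BB'] := qP k ev evq.
have LL' : has_valuemx ev
    (fmx (J' := A) (m' := fun e => a (s e)) (n' := fun e => b (t e)) (dform V W))
    (fmx (J' := A) (m' := fun e => a (s e)) (n' := fun e => b (t e)) (dform V' W')).
  move=> i j; rewrite !fmx_entry; set e := enum_val j.
  have delta v : has_valuemx ev
     (funvec (delta_mx 0 i : 'rV[K]_#|fidx a b|) v) (funvec (delta_mx 0 i) v).
    by move=> r c; rewrite !mxE; apply: has_value_nat.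
  suff val : has_valuemx ev (dform V W (funvec (delta_mx 0 i)) (tag e))
                            (dform V' W' (funvec (delta_mx 0 i)) (tag e)).
    exact: val.
  apply: has_valuemx_sub.
    exact: has_valuemx_mul (delta _) (WW' _).
  exact: has_valuemx_mul (VV' _) (delta _).
have LB' : fmx (dform V' W') *m B' tt = 1%:M.
  apply: has_valuemx_uniq (has_valuemx_mul LL' (BB' tt)) _.
  by rewrite LB; apply: has_valuemx1.
move=> x x0 v.
have E : fvec x = 0.
  rewrite -[fvec x]mulmx1 -LB' mulmxA -(fmxE (dform_flinear V' W')).
  rewrite (_ : fvec _ = 0) ?mul0mx //.
  by apply/rowP => i; rewrite mxE x0 !mxE.
by rewrite -[x]fvecK E; apply/matrixP => ? ?; rewrite !mxE.
Qed.

Lemma subrep_specialize b d (W : arrfam K s t b b) (U : fam K d b) (S : fam K b d)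
    (B : arrfam K s t d d) :
  (forall v, U v *m S v = 1%:M) ->
  (forall e, U (s e) *m W e = B e *m U (t e)) ->
  exists2 q : R, q != 0 &
  forall (k : fieldType) (ev : {rmorphism R -> k}) (W' : arrfam k s t b b),
    ev q != 0 -> (forall e, has_valuemx ev (W e) (W' e)) ->
    exists (U' : fam k d b) (S' : fam k b d) (B' : arrfam k s t d d),
      (forall v, U' v *m S' v = 1%:M) /\
      (forall e, U' (s e) *m W' e = B' e *m U' (t e)).
Proof.
move=> US UW.
have [q1 q10 q1P] := specialize_family U.
have [q2 q20 q2P] := specialize_family S.
have [q3 q30 q3P] := specialize_family (J := A) (m := fun e => d (s e)) (n :=
    fun e => d (t e)) B.
exists (q1 * q2 * q3); first by rewrite !mulf_neq0.
move=> k ev W'; rewrite !rmorphM !mulf_eq0 !negb_or => /andP[/andP[e1 e2] e3] WW'.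
have [U' UU'] := q1P k ev e1; have [S' SS'] := q2P k ev e2.
have [B' BB'] := q3P k ev e3; exists U', S', B'; split=> [v|e].
  apply: has_valuemx_uniq (has_valuemx_mul (UU' v) (SS' v)) _.
  by rewrite US; apply: has_valuemx1.
apply: has_valuemx_uniq (has_valuemx_mul (UU' _) (WW' e)) _.
by rewrite UW; apply: has_valuemx_mul.
Qed.

End Specialization.

Section Framed.
Variables (n : nat) (Q : quiver n).

(** The quiver Q with a new vertex v' and an arrow v' -> v for each vertex v. A
    presentation P(g1) -> P(g0) is a representation of it: P(g0) on Q, and at v'
    the space k^(g1 v), mapped to P(g0)_v by the images of the generators. *)
Definition frame_src (e : arrow Q + 'I_n) : 'I_n + 'I_n :=
  match e with inl a => inl (src a) | inr v => inr v end.
Definition frame_tgt (e : arrow Q + 'I_n) : 'I_n + 'I_n :=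
  match e with inl a => inl (tgt a) | inr v => inl v end.
Definition frame_dim (d g : dimvec n) (x : 'I_n + 'I_n) : nat :=
  match x with inl v => d v | inr v => g v end.

Definition framed (F : fieldType) (d g : dimvec n) (M : rep Q F d) (f : fam F g d) :
    arrfam F frame_src frame_tgt (frame_dim d g) (frame_dim d g) :=
  fun e => match e with inl a => M a | inr v => f v end.

(** A representation of Q extended by zero; the morphisms from a framed P(g0) to
    it are the morphisms from the cokernel of the presentation. *)
Definition unframed (F : fieldType) (d : dimvec n) (M : rep Q F d) :
    arrfam F frame_src frame_tgt (frame_dim d (fun=> 0%N)) (frame_dim d (fun=>
        0%N)) :=
  framed M (fun v => 0 : 'M_(0, d v)).

(** Derivations may be prescribed on the entries of f and M. *)
Definition generic (F : fieldType) (d g b : dimvec n) (f : fam F g d) (M : rep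
    Q F b) :=
  forall (f' : fam F g d) (M' : rep Q F b),
  exists D, [/\ derivation D, forall v, map_mx D (f v) = f' v &
                forall a, map_mx D (M a) = M' a].

Hypothesis acyclic : no_oriented_cycles Q.

Lemma proj_rigid (F : fieldType) g d (N : rep Q F d)
  (c : arrfam F src tgt (pdim Q g) d) :
  exists x, forall a, dform (proj F g) N x a = c a.
Proof.
have [x _ xE] := extend_gens acyclic N (fun v => 0 : 'M_(g v, d v)) c.
by exists x => a; rewrite /dform xE opprB addrC subrK.
Qed.

(** By [proj_rigid] a deformation of the framed P(g0) may be moved to the framing,
    where it is the derivative of the generic entries. *)
Lemma generic_versal (F : fieldType) g0 g1 b (f : fam F g1 (pdim Q g0)) (M :
    rep Q F b) :
  generic f M -> versal (framed (proj F g0) f) (unframed M).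
Proof.
move=> gen V' W'.
have [X XE] := proj_rigid (proj F g0) (fun a => - V' (inl a)).
have [D [dD Df DM]] := gen (fun v => V' (inr v) - f v *m X v) (fun a => W' (inl a)).
exists D.
exists (fun x : 'I_n + 'I_n => match x return 'M_(frame_dim _ _ x) with inl v
    => X v | inr v => 0 end).
exists (fun x => 0); split=> // -[a|v].
- have := XE a; rewrite /dform /= => ->; rewrite subrr.
  by apply/matrixP => i j; rewrite !mxE derivation_nat.
- by rewrite /dform /= Df mul0mx sub0r.
- by rewrite /dform /= mul0mx mulmx0 subrr addr0 DM.
- by rewrite /dform /=; apply/matrixP => -[].
Qed.

(** Dimension count for 0 -> Hom(P(g), N) -> C0 -> C1 -> 0, where C0 -> C1 is
    [dform] and Hom(P(g), N) is given by the images of the generators. *)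
Lemma pdim_euler (d g : dimvec n) :
  (\sum_v pdim Q g v * d v = \sum_v g v * d v +
   \sum_(a : arrow Q) pdim Q g (src a) * d (tgt a))%N.
Proof.
(* Any representation over any field will do. *)
pose N : rep Q rat d := fun a => 0.
pose J := ('I_n + arrow Q)%type.
pose m (j : J) := match j with inl v => g v | inr a => pdim Q g (src a) end.
pose m' (j : J) := match j with inl v => d v | inr a => d (tgt a) end.
pose L (x : fam rat (pdim Q g) d) : mfam rat m m' :=
  fun j => match j with inl v => gens x v | inr a => dform (proj rat g) N x a end.
have linL : flinear (J := 'I_n) L.
  move=> c x y [v|a] /=.
    by apply/matrixP => i j; rewrite !mxE.
  exact: dform_flinear.
have injL x : (forall j, L x j = 0) -> forall j, x j = 0.
  move=> x0; apply: (hom_gens0 acyclic (N := N)) => [a|v].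
    by apply/esym/subr0_eq; apply: (x0 (inr a)).
  exact: (x0 (inl v)).
have surjL y : exists x, L x = y.
  have [x x1 x2] := extend_gens acyclic N (fun v => y (inl v)) (fun a => y (inr a)).
  exists x; apply: functional_extensionality_dep => -[v|a] /=; first exact: x1.
  by rewrite /dform x2 opprB addrC subrK.
rewrite (flinear_bij_eq linL injL surjL).
by rewrite big_sumType.
Qed.

End Framed.

Section FreeHom.
Variables (n : nat) (Q : quiver n) (F : fieldType).
Hypothesis acyclic : no_oriented_cycles Q.
Notation gens := (@gens n Q F _ _).
Notation genidx g v := (fun i : 'I_(g v) => enum_rank (pgen Q i) : 'I_(pdim Q g v)).

Lemma free_hom_exists g d (N : rep Q F d) (x0 : fam F g d) :
  exists f : Defs.hom (proj F g) N, forall v, gens f v = x0 v.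
Proof.
have [x xg xh] := extend_gens acyclic N x0 (fun a => 0).
have hx : is_hom (proj F g) N x by move=> a; rewrite xh subr0.
by exists (Defs.Hom hx).
Qed.

Definition free_hom g d (N : rep Q F d) (x0 : fam F g d) : Defs.hom (proj F g) N :=
  projT1 (cid (free_hom_exists N x0)).

Lemma gens_free_hom g d (N : rep Q F d) (x0 : fam F g d) v :
  gens (free_hom N x0) v = x0 v.
Proof. exact: (projT2 (cid (free_hom_exists N x0))). Qed.

Lemma hom_ext g d (N : rep Q F d) (f h : Defs.hom (proj F g) N) :
  (forall v, gens f v = gens h v) -> forall v, f v = h v.
Proof.
move=> E v; apply: subr0_eq.
apply: (hom_gens0 acyclic (N := N) (x := fun v => f v - h v)) => [a|u].
  by rewrite mulmxBr mulmxBl !homP.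
by apply/matrixP => i j; have /matrixP/(_ i j) := E u; rewrite !mxE => ->;
    rewrite subrr.
Qed.

Section Pullback.
Variables (d : dimvec n) (N : rep Q F d).

(** Hom(phi, N) on families of images of generators. *)
Definition pull g0 g1 (phi : projhom Q F g0 g1) (x : fam F g0 d) : fam F g1 d :=
  fun v => gens phi v *m free_hom N x v.

Lemma pullE g0 g1 (phi : projhom Q F g0 g1) x v :
  pull phi x v = gens (hom_comp (free_hom N x) phi) v.
Proof. by rewrite /pull -[RHS]mul_rowsub_mx. Qed.

Lemma free_hom_pull g0 g1 (phi : projhom Q F g0 g1) x v :
  free_hom N (pull phi x) v = phi v *m free_hom N x v.
Proof.
by apply: (@hom_ext _ _ _ _ (hom_comp (free_hom N x) phi)) => u;
  rewrite gens_free_hom pullE.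
Qed.

Lemma pull_comp g0 g1 g2 (phi : projhom Q F g0 g1) (psi : projhom Q F g1 g2) x v :
  pull (hom_comp phi psi) x v = pull psi (pull phi x) v.
Proof.
rewrite /pull free_hom_pull mulmxA; congr (_ *m _).
exact/esym/mul_rowsub_mx.
Qed.

Lemma free_hom_linear g c (x y : fam F g d) v :
  free_hom N (fun i => c *: x i + y i) v = c *: free_hom N x v + free_hom N y v.
Proof.
have hz : is_hom (proj F g) N (fun v => c *: free_hom N x v + free_hom N y v).
  by move=> a; rewrite mulmxDr mulmxDl -scalemxAr -scalemxAl !homP.
apply: (@hom_ext _ _ _ _ (Defs.Hom hz)) => u; rewrite gens_free_hom.
have Ex := gens_free_hom N x u; have Ey := gens_free_hom N y u.
by rewrite -Ex -Ey; apply/matrixP => i j; rewrite !mxE.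
Qed.

Lemma pull_flinear g0 g1 (phi : projhom Q F g0 g1) : flinear (pull phi).
Proof.
by move=> c x y v; rewrite /pull free_hom_linear mulmxDr -scalemxAr.
Qed.

End Pullback.

Section DiagonalBlocks.

(** The part of a morphism of projectives which lies outside the radical, as a map
    on generators at the vertex v. *)
Definition gdiag g g' (h : Defs.hom (proj F g) (proj F g')) v : 'M[F]_(g v, g' v) :=
  colsub (genidx g' v) (gens h v).

Lemma gdiagE g (h : Defs.hom (proj F g) (proj F g)) v : diag_block h v = gdiag h v.
Proof. by apply/matrixP => i j; rewrite !mxE. Qed.

Lemma proj_gen_col g (a : arrow Q) j :
  col (enum_rank (pgen Q j)) (proj F g a : 'M_(pdim Q g (src a), pdim Q g (tgt
      a))) = 0.
Proof.
have nil_rcons (p : seq (arrow Q)) : ([::] == rcons p a) = false by case: p.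
by apply/colP => i; rewrite !mxE !enum_rankK /= nil_rcons andbF.
Qed.

(** Paths of positive length never hit a generator, so modulo the radical only the
    images of generators count. *)
Lemma col_gens g g' (h : Defs.hom (proj F g) (proj F g')) v :
  colsub (genidx g' v) (h v) = colsub (genidx g v) 1%:M *m gdiag h v.
Proof.
suff E : (fun u => colsub (genidx g' u) (h u)) =
    (fun u => colsub (genidx g u) 1%:M *m gdiag h u) :> fam F (pdim Q g) g'.
  exact: (congr1 (fun x : fam F _ _ => x v) E).
apply: rows_eq => {v} w; move: w.
apply: (pbasis_ind (acyclic := acyclic)) => [v i|a b _].
  rewrite row_mul (_ : row _ (colsub _ _) = delta_mx 0 i).
    by rewrite -rowE; apply/rowP => j; rewrite !mxE.
  apply/rowP => j; rewrite !mxE (inj_eq enum_rank_inj) eqxx /=.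
  congr ((nat_of_bool _)%:R); apply/eqP/eqP => [E|->] //.
  have := congr1 (fun b => val b) E => /= -[].
  by move/eqP; rewrite -tag_eqE /tag_eq /= eqxx /= tagged_asE => /eqP.
rewrite row_mul (_ : row _ (colsub _ 1%:M) = 0) ?mul0mx.
  have := proj_row acyclic b (h (tgt a)); rewrite homP => E.
  apply/rowP => j; have /rowP/(_ (enum_rank (pgen Q j))) := E; rewrite !mxE => <-.
  apply: big1 => c _; have /colP/(_ c) := proj_gen_col j; rewrite !mxE => ->.
  by rewrite mulr0.
apply/rowP => j; rewrite !mxE (inj_eq enum_rank_inj).
case: eqP => // E; have [_] := pextE acyclic b; rewrite E /=.
by move/(congr1 size); rewrite size_rcons.
Qed.

Lemma gdiag_comp g g' g'' (f : Defs.hom (proj F g') (proj F g''))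
    (h : Defs.hom (proj F g) (proj F g')) v :
  gdiag (hom_comp f h) v = gdiag h v *m gdiag f v.
Proof.
have := col_gens f v => /(congr1 (fun M => gens h v *m M)).
rewrite mulmxA => E.
rewrite /gdiag /= [LHS](_ : _ = gens h v *m colsub (genidx g'' v) (f v)); last first.
  by rewrite mulmx_colsub mul_rowsub_mx.
rewrite E -/(gdiag h v) -/(gdiag f v); congr (_ *m _).
by rewrite mulmx_colsub; congr (colsub _ _); apply: mulmx1.
Qed.

End DiagonalBlocks.
End FreeHom.

(** * Destabilizing one-parameter subgroups *)

Section IdempotentDet.
Variable F : fieldType.

Lemma det_sylvester m n (A : 'M[F]_(n, m)) (B : 'M_(m, n)) :
  \det (1%:M + A *m B) = \det (1%:M + B *m A).
Proof.
have E1 : block_mx 1%:M (- B) A 1%:M =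
    block_mx 1%:M 0 A 1%:M *m block_mx 1%:M (- B) 0 (1%:M + A *m B).
  rewrite mulmx_block !(mulmx1, mul1mx, mul0mx, mulmx0, addr0).
  by rewrite mulmxN addrCA addNr addr0.
have E2 : block_mx 1%:M (- B) A 1%:M =
    block_mx (1%:M + B *m A) (- B) 0 1%:M *m block_mx 1%:M 0 A 1%:M.
  rewrite mulmx_block !(mulmx1, mul1mx, mul0mx, mulmx0, add0r).
  by rewrite mulNmx addrK.
have := congr1 determinant E1; rewrite E2 !det_mulmx.
by rewrite !(det_lblock, det_ublock) !det1 !mul1r !mulr1.
Qed.

(** A B is an idempotent of rank m. *)
Lemma det_idempotent m n (A : 'M[F]_(n, m)) (B : 'M_(m, n)) c : B *m A = 1%:M ->
  \det (1%:M + (c - 1) *: (A *m B)) = c ^+ m.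
Proof.
move=> BA; rewrite scalemxAl det_sylvester -scalemxAr BA.
rewrite (_ : _ + _ = c%:M) ?det_scalar //.
by apply/matrixP => i j; rewrite !mxE; case: (i == j); rewrite ?mulr1n ?mulr0n; ring.
Qed.

End IdempotentDet.

Section HomOps.
Variables (n : nat) (Q : quiver n) (F : fieldType).

Definition hom_scale d d' (M : rep Q F d) (N : rep Q F d') (c : F) (f : hom M N) :
  hom M N.
Proof.
by exists (fun v => c *: f v) => a; rewrite -scalemxAr homP scalemxAl.
Defined.

(** If s is a section of p, this is multiplication by c on the image of s and the
    identity on the kernel of p: for varying c, a one-parameter subgroup. *)
Definition idem_scale d d' (M : rep Q F d) (N : rep Q F d') (c : F)
    (p : hom M N) (s : hom N M) : hom M M :=
  hom_add (hom_id M) (hom_scale (c - 1) (hom_comp s p)).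

Section Idem.
Variables (d d' : dimvec n) (M : rep Q F d) (N : rep Q F d').
Variables (p : hom M N) (s : hom N M).
Hypothesis sp : forall v, s v *m p v = 1%:M.

Lemma idem_scale_comp b c v :
  idem_scale b p s v *m idem_scale c p s v = idem_scale (b * c) p s v.
Proof.
rewrite /= mulmxDl mul1mx mulmxDr mulmx1 -scalemxAl -scalemxAr.
rewrite -mulmxA (mulmxA (s v)) sp mul1mx scalerA -!addrA; congr (_ + _).
by rewrite -!scalerDl; congr (_ *: _); ring.
Qed.

Lemma idem_scale_aut c : c != 0 -> is_aut (idem_scale c p s).
Proof.
move=> c0; exists (idem_scale c^-1 p s); split=> v.
  rewrite [LHS]idem_scale_comp mulVf // /= subrr scale0r addr0 //.
by rewrite [LHS]idem_scale_comp mulfV // /= subrr scale0r addr0.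
Qed.

End Idem.

Lemma hom_scale_aut d (M : rep Q F d) c (h : hom M M) : c != 0 -> is_aut h ->
  is_aut (hom_scale c h).
Proof.
move=> c0 [h' [h1 h2]]; exists (hom_scale c^-1 h'); split=> v /=.
  by rewrite -scalemxAl -scalemxAr scalerA mulVf // scale1r; exact: h1.
by rewrite -scalemxAl -scalemxAr scalerA mulfV // scale1r; exact: h2.
Qed.

Lemma hom_id_aut d (M : rep Q F d) : is_aut (hom_id M).
Proof. by exists (hom_id M); split=> v; rewrite /= mul1mx. Qed.

Local Notation prj := (@proj n Q F).

Hypothesis acyclic : no_oriented_cycles Q.

Lemma diag_block_id g v : diag_block (hom_id (prj g)) v = 1%:M.
Proof.
apply/matrixP => i j; rewrite !mxE (inj_eq enum_rank_inj).
congr ((nat_of_bool _)%:R); apply/eqP/eqP => [E|->] //.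
have := congr1 (fun b => val b) E => /= -[].
by move/eqP; rewrite -tag_eqE /tag_eq /= eqxx /= tagged_asE => /eqP.
Qed.

Lemma diag_block_scale g c (h : hom (prj g) (prj g)) v :
  diag_block (hom_scale c h) v = c *: diag_block h v.
Proof. by apply/matrixP => i j; rewrite !mxE. Qed.

Lemma diag_block_add g (h h' : hom (prj g) (prj g)) v :
  diag_block (hom_add h h') v = diag_block h v + diag_block h' v.
Proof. by apply/matrixP => i j; rewrite !mxE. Qed.

Lemma det_diag_idem_scale g g' (p : hom (prj g) (prj g'))
    (s : hom (prj g') (prj g)) c v : (forall v, s v *m p v = 1%:M) ->
  \det (diag_block (idem_scale c p s) v) = c ^+ (g' v).
Proof.
move=> sp; rewrite diag_block_add diag_block_id diag_block_scale gdiagE gdiag_comp //.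
apply: det_idempotent; rewrite -gdiag_comp // -[RHS](@diag_block_id g' v) gdiagE.
by rewrite /gdiag /gens /= sp.
Qed.

Lemma chi_expn g beta (h : hom (prj g) (prj g)) (m : 'I_n -> nat) c :
  (forall v, \det (diag_block h v) = c ^+ m v) ->
  chi (cvec int beta) h = c ^+ (\sum_v m v * beta v).
Proof.
move=> E; rewrite /chi -prodrXr; apply: eq_bigr => v _.
by rewrite E mxE natz -exprnP -exprM.
Qed.

Lemma chi_scale g beta c (h : hom (prj g) (prj g)) :
  chi (cvec int beta) (hom_scale c h) =
  c ^+ (\sum_v g v * beta v) * chi (cvec int beta) h.
Proof.
rewrite /chi -prodrXr -big_split /=; apply: eq_bigr => v _.
by rewrite diag_block_scale detZ mxE natz -!exprnP exprMn exprM.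
Qed.

Lemma chi_id g beta : chi (cvec int beta) (hom_id (prj g)) = 1.
Proof.
rewrite (@chi_expn _ _ _ (fun=> 0%N) 1) ?expr1n // => v.
by rewrite diag_block_id det1.
Qed.

End HomOps.

Section Copies.
Variables (n : nat) (Q : quiver n) (F : fieldType) (g d : dimvec n).
Hypothesis acyclic : no_oriented_cycles Q.
Local Notation lgen v := (fun i : 'I_(g v) =>
  enum_rank (pgen Q (lshift (d v) i : 'I_(addv g d v))) : 'I_(pdim Q (addv g d) v)).
Local Notation rgen v := (fun i : 'I_(d v) =>
  enum_rank (pgen Q (rshift (g v) i : 'I_(addv g d v))) : 'I_(pdim Q (addv g d) v)).
Local Notation gen1 h v := (rowsub (fun i : 'I_(h v) =>
  enum_rank (pgen Q i) : 'I_(pdim Q h v)) 1%:M).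

Lemma pgenP h v (i : 'I_(h v)) (c : pbasis Q h v) :
  (c == pgen Q i) = ((val c).1 == Tagged (fun v => 'I_(h v)) i) && ((val c).2
      == [::] :> seq _).
Proof. by apply/eqP/andP => [->|[/eqP e1 /eqP e2]] //; apply: pbasis_eq. Qed.

Lemma lcopy_inj : injective (@lcopy n g d).
Proof.
move=> [v i] [u j] E; have /= vu := congr1 tag E; subst u.
by have := E => /eqP; rewrite -tag_eqE /tag_eq /= eqxx /= tagged_asE => /eqP
    /lshift_inj /= ->.
Qed.

Lemma rcopy_inj : injective (@rcopy n g d).
Proof.
move=> [v i] [u j] E; have /= vu := congr1 tag E; subst u.
by have := E => /eqP; rewrite -tag_eqE /tag_eq /= eqxx /= tagged_asE => /eqP
    /rshift_inj /= ->.
Qed.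

Lemma lcopy_rcopy x y : (lcopy d x == rcopy g y) = false.
Proof.
case: x y => [v i] [u j]; apply/eqP => E; have /= vu := congr1 tag E; subst u.
by have := E => /eqP; rewrite -tag_eqE /tag_eq /= eqxx /= tagged_asE eq_lrshift.
Qed.

Lemma eq_pgen_rank h v (i : 'I_(h v)) j :
  (enum_rank (pgen Q i) == j) = (enum_val j == pgen Q i).
Proof. by rewrite -(inj_eq enum_val_inj) enum_rankK eq_sym. Qed.

Lemma gens_linj v : gens (linj Q F g d) v = rowsub (lgen v) 1%:M.
Proof.
apply/matrixP => i j; rewrite !mxE enum_rankK eq_pgen_rank pgenP.
by congr ((nat_of_bool (_ && _))%:R); rewrite eq_sym.
Qed.

Lemma gens_rinj v : gens (rinj Q F g d) v = rowsub (rgen v) 1%:M.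
Proof.
apply/matrixP => i j; rewrite !mxE enum_rankK eq_pgen_rank pgenP.
by congr ((nat_of_bool (_ && _))%:R); rewrite eq_sym.
Qed.

Lemma lgen_lprj v : rowsub (lgen v) (lprj Q F g d v) = gen1 g v.
Proof.
apply/matrixP => i j; rewrite !mxE enum_rankK eq_pgen_rank pgenP /=.
rewrite (_ : Tagged _ _ = lcopy d (Tagged (fun v => 'I_(g v)) i)) // (inj_eq
    lcopy_inj).
by congr ((nat_of_bool (_ && _))%:R); rewrite eq_sym.
Qed.

Lemma rgen_rprj v : rowsub (rgen v) (rprj Q F g d v) = gen1 d v.
Proof.
apply/matrixP => i j; rewrite !mxE enum_rankK eq_pgen_rank pgenP /=.
rewrite (_ : Tagged _ _ = rcopy g (Tagged (fun v => 'I_(d v)) i)) // (inj_eq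
    rcopy_inj).
by congr ((nat_of_bool (_ && _))%:R); rewrite eq_sym.
Qed.

Lemma lgen_rprj v : rowsub (lgen v) (rprj Q F g d v) = 0.
Proof.
apply/matrixP => i j; rewrite !mxE enum_rankK /=.
rewrite (_ : Tagged _ _ = lcopy d (Tagged (fun v => 'I_(g v)) i)) //.
by rewrite lcopy_rcopy.
Qed.

Lemma rgen_lprj v : rowsub (rgen v) (lprj Q F g d v) = 0.
Proof.
apply/matrixP => i j; rewrite !mxE enum_rankK /=.
rewrite (_ : Tagged _ _ = rcopy g (Tagged (fun v => 'I_(d v)) i)) //.
by rewrite eq_sym lcopy_rcopy.
Qed.

Definition hom0 e e' (M : rep Q F e) (N : rep Q F e') : hom M N.
Proof. by exists (fun v => 0) => a; rewrite mulmx0 mul0mx. Defined.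

Lemma linj_lprj v : linj Q F g d v *m lprj Q F g d v = 1%:M.
Proof.
apply: (hom_ext acyclic (f := hom_comp (lprj Q F g d) (linj Q F g d))
  (h := hom_id (proj F g))) => u.
rewrite [LHS](_ : _ = gens (linj Q F g d) u *m lprj Q F g d u); last first.
  by rewrite mul_rowsub_mx.
by rewrite gens_linj mul_rowsub_mx mul1mx lgen_lprj.
Qed.

Lemma rinj_rprj v : rinj Q F g d v *m rprj Q F g d v = 1%:M.
Proof.
apply: (hom_ext acyclic (f := hom_comp (rprj Q F g d) (rinj Q F g d))
  (h := hom_id (proj F d))) => u.
rewrite [LHS](_ : _ = gens (rinj Q F g d) u *m rprj Q F g d u); last first.
  by rewrite mul_rowsub_mx.
by rewrite gens_rinj mul_rowsub_mx mul1mx rgen_rprj.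
Qed.

Lemma linj_rprj v : linj Q F g d v *m rprj Q F g d v = 0.
Proof.
apply: (hom_ext acyclic (f := hom_comp (rprj Q F g d) (linj Q F g d))
  (h := hom0 (proj F g) (proj F d))) => u.
rewrite [LHS](_ : _ = gens (linj Q F g d) u *m rprj Q F g d u); last first.
  by rewrite mul_rowsub_mx.
by rewrite gens_linj mul_rowsub_mx mul1mx lgen_rprj; apply/matrixP => ? ?;
    rewrite !mxE.
Qed.

Lemma rinj_lprj v : rinj Q F g d v *m lprj Q F g d v = 0.
Proof.
apply: (hom_ext acyclic (f := hom_comp (lprj Q F g d) (rinj Q F g d))
  (h := hom0 (proj F d) (proj F g))) => u.
rewrite [LHS](_ : _ = gens (rinj Q F g d) u *m lprj Q F g d u); last first.
  by rewrite mul_rowsub_mx.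
by rewrite gens_rinj mul_rowsub_mx mul1mx rgen_lprj; apply/matrixP => ? ?;
    rewrite !mxE.
Qed.

End Copies.

(** For c = 1/t - 1 the left-hand side is the orbit of X under a pair of
    one-parameter subgroups; by the right-hand side it is affine in t. *)
Lemma sandwich_scale (F : fieldType) m p (L : 'M[F]_m) (X : 'M_(m, p)) (Z :
    'M_p) t c :
  L *m X *m Z = 0 ->
  (1%:M + c *: L) *m X *m (t *: (1%:M + c *: Z)) =
  t *: X + (t * c) *: (X *m Z + L *m X).
Proof.
move=> LXZ; rewrite mulmxDl mul1mx -scalemxAl -scalemxAr mulmxDr mulmx1 -scalemxAr.
rewrite mulmxDl -scalemxAl LXZ scaler0 addr0.
by apply/matrixP => i j; rewrite !mxE; ring.
Qed.

Section SemiInvariants.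
Variables (n : nat) (Q : quiver n) (k : closedFieldType).
Hypothesis acyclic : no_oriented_cycles Q.
Local Notation prj := (@proj n Q k).

Lemma polynomial_fun_ext d d' (M : rep Q k d) (N : rep Q k d') (f : hom M N -> k)
    (phi psi : hom M N) :
  polynomial_fun f -> (forall v, phi v = psi v) -> f phi = f psi.
Proof.
case=> p fp E; rewrite !fp; apply: meval_eq => i.
by rewrite /hom_coord E.
Qed.

Lemma polynomial_fun_line d d' (M : rep Q k d) (N : rep Q k d') (f : hom M N -> k)
    (phi psi : hom M N) :
  polynomial_fun f -> exists q : {poly k}, forall t,
  f (hom_add (hom_scale t phi) (hom_scale (1 - t) psi)) = q.[t].
Proof.
case=> p fp.
exists (mmap polyC (fun i => (hom_coord phi i)%:P * 'X + (hom_coord psi i)%:P *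
    (1 - 'X)) p) => t.
rewrite fp mevalE /mmap horner_sum; apply: eq_bigr => m _.
rewrite hornerM hornerC /mmap1 horner_prod; congr (_ * _); apply: eq_bigr => i _.
rewrite horner_exp; congr (_ ^+ _); rewrite !hornerE /hom_coord /= !mxE.
ring.
Qed.

(** Otherwise c / t^m would be a polynomial in t. *)
Lemma constant_vanishes (q : {poly k}) m c : (0 < m)%N ->
  (forall t, t != 0 -> t ^+ m * q.[t] = c) -> c = 0.
Proof.
move=> m0 h; apply/eqP/negPn/negP => c0.
have : 'X * ('X^m * q - c%:P) != 0.
  rewrite mulf_neq0 ?polyX_eq0 //; apply: contra c0 => /eqP/(congr1 (horner^~ 0)).
  by rewrite !hornerE expr0n eqn0Ngt m0 mul0r sub0r => /eqP; rewrite oppr_eq0.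
case/closed_nonrootP => t; rewrite rootM rootX negb_or => /andP[t0].
by rewrite /root !hornerE h // subrr eqxx.
Qed.

(** The scalars t and 1/t on P(g0) and P(g1) act trivially together. *)
Lemma semi_invariant_balanced beta g0 g1 (f : projhom Q k g0 g1 -> k) phi :
  semi_invariant (cvec int beta) f -> f phi != 0 ->
  (\sum_v g0 v * beta v = \sum_v g1 v * beta v)%N.
Proof.
move=> [fp fsi] f0; set A := (\sum_v g0 v * beta v)%N; set B := (\sum_v _)%N.
have tAB (t : k) : t != 0 -> t ^+ A = t ^+ B.
  move=> t0; have := fsi (hom_scale t (hom_id _)) (hom_scale t^-1 (hom_id _))
    (hom_scale_aut t0 (hom_id_aut _))
    (hom_scale_aut (invr_neq0 t0) (hom_id_aut _)) phi.
  rewrite !chi_scale !chi_id !mulr1 (@polynomial_fun_ext _ _ _ _ f _ phi fp).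
    rewrite -[LHS]mul1r => /(mulIf f0) E.
    by rewrite -/A -/B exprVn in E; rewrite -[RHS]mul1r E mulfVK ?expf_neq0.
  by move=> v /=; rewrite -scalemxAr mulmx1 -scalemxAl mul1mx scalerA mulfV //
      scale1r.
apply/eqP/negPn/negP => AB.
have : 'X * ('X^A - 'X^B) != 0 :> {poly k}.
  rewrite mulf_neq0 ?polyX_eq0 //; rewrite subr_eq0; apply: contra AB => /eqP E.
  by have := congr1 (fun p : {poly k} => size p) E; rewrite !size_polyXn => -[->].
case/closed_nonrootP => t; rewrite rootM rootX negb_or => /andP[t0].
by rewrite /root !hornerE tAB // subrr eqxx.
Qed.

Section HilbertMumford.
Variables (g0 g1 tau : dimvec n) (phi : projhom Q k g0 g1).
Variables (Y : rep Q k tau) (y : hom (prj g0) Y) (z : fam k tau (pdim Q g0)).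
Hypothesis zy : forall v, z v *m y v = 1%:M.
Hypothesis phiy : forall v, phi v *m y v = 0.

(** Generators at v of the first term Q1 of the standard resolution
    0 -> Q1 -> P(tau) -> Y -> 0, which is the sum over all arrows a of
    P(tgt a) (x) Y_(src a). *)
Definition relidx v : finType :=
  {c : {a : arrow Q & 'I_(tau (src a))} | tgt (tag c) == v}.
Definition rel_dim : dimvec n := fun v => #|relidx v|.

Lemma sum_rel_dim (b : dimvec n) :
  (\sum_v rel_dim v * b v = \sum_(a : arrow Q) tau (src a) * b (tgt a))%N.
Proof.
have E v : (rel_dim v = \sum_(a : arrow Q | tgt a == v) tau (src a))%N.
  rewrite /rel_dim card_sig -sum1_card.
  rewrite [RHS](eq_bigr (fun a => \sum_(j < tau (src a)) 1)%N) => [|a _]; last first.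
    by rewrite sum1_card card_ord.
  rewrite (sig_big_dep (fun a : arrow Q => tgt a == v)
    (fun a (_ : 'I_(tau (src a))) => true) (fun _ _ => 1%N)).
  by apply: eq_bigl => c; rewrite andbT.
under eq_bigr do rewrite E big_distrl /=.
rewrite (exchange_big_dep predT) //=; apply: eq_bigr => a _.
by rewrite (eq_bigl (fun v => v == tgt a)) ?big_pred1_eq // => v; rewrite eq_sym.
Qed.

(* Generators of P(tau); the cover P(tau) -> Y; below, dd : Q1 -> P(tau). *)
Local Notation gin := (fun v => gens (hom_id (prj tau)) v).
Local Notation eps := (free_hom acyclic Y (fun v => 1%:M : 'M_(tau v))).

Lemma gin_mul (d : dimvec n) (N : rep Q k d) (f : hom (prj tau) N) v :
  gin v *m f v = gens f v.
Proof. by rewrite mul_rowsub_mx; congr (rowsub _ _); apply: mul1mx. Qed.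

(** Y_a as a relation: following the arrow a from a generator agrees in Y with the
    combination of generators at the target given by Y_a. *)
Definition relation_mx (a : arrow Q) : 'M[k]_(tau (src a), pdim Q tau (tgt a)) :=
  gin (src a) *m proj k tau a - Y a *m gin (tgt a).

Definition relation_gens : fam k rel_dim (pdim Q tau) := fun v =>
  \matrix_(i < rel_dim v) (row (tagged (val (enum_val i))) (relation_mx (tag
      (val (enum_val i)))) *m
     transport k (pdim Q tau) (tgt (tag (val (enum_val i)))) v).

Local Notation dd := (free_hom acyclic (prj tau) relation_gens).

Lemma relation_sub a : (relation_mx a <= dd (tgt a))%MS.
Proof.
apply/row_subP => i.
pose c : relidx (tgt a) := exist _ (Tagged (fun a : arrow Q => 'I_(tau (src
    a))) i) (eqxx _).
have : row (enum_rank (pgen Q (enum_rank c : 'I_(rel_dim (tgt a))))) (dd (tgt a)) =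
   row i (relation_mx a).
  by rewrite -row_gens gens_free_hom rowK enum_rankK /= transport_id mulmx1.
by move<-; apply: row_sub.
Qed.

(** Exactness of the standard resolution at P(tau): the relations allow to replace
    a path by generators at its end point, one arrow at a time. *)
Lemma resolution_exact v : (1%:M - eps v *m gin v <= dd v)%MS.
Proof.
suff E w (b : pbasis Q tau w) :
    (row (enum_rank b) (1%:M - eps w *m gin w) <= dd w)%MS.
  by apply/row_subP => i; have := E v (enum_val i); rewrite enum_valK.
move: w b; apply: (pbasis_ind (acyclic := acyclic)) => [u i|a b IH].
  rewrite linearB /= row_mul -row_gens gens_free_hom -row_mul mul1mx.
  rewrite row_gens subrr; exact: sub0mx.
rewrite -(proj_row acyclic) mulmxBr mulmx1 mulmxA homP -mulmxA.
have -> : proj k tau a - eps (src a) *m (Y a *m gin (tgt a)) =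
   (1%:M - eps (src a) *m gin (src a)) *m proj k tau a + eps (src a) *m relation_mx a.
  by rewrite mulmxBr mulmxBl mul1mx !mulmxA addrA subrK.
rewrite linearD /= !row_mul addmx_sub //; last first.
  exact: submx_trans (submxMl _ _) (relation_sub a).
have /submxP[D ->] := IH.
by rewrite -mulmxA -homP mulmxA submxMl.
Qed.

Lemma eps_sub m v (r : 'M_(m, pdim Q tau v)) : r *m eps v = 0 -> (r <= dd v)%MS.
Proof.
move=> r0; have -> : r = r *m (1%:M - eps v *m gin v).
  by rewrite mulmxBr mulmx1 mulmxA r0 mul0mx subr0.
exact: submx_trans (submxMl _ _) (resolution_exact v).
Qed.

Definition lift_hom : hom (prj g0) (prj tau) :=
  free_hom acyclic (prj tau) (fun v => gens y v *m gin v).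
Local Notation ll := lift_hom.

Lemma lift_eps v : ll v *m eps v = y v.
Proof.
apply: (hom_ext acyclic (f := hom_comp eps ll)) => u.
rewrite -[LHS]mul_rowsub_mx -/(gens ll u) gens_free_hom -mulmxA gin_mul.
by rewrite gens_free_hom mulmx1.
Qed.

(** As phi y = 0, the lift of y to P(tau) sends the image of phi to that of Q1. *)
Lemma lift1_exists : exists l1 : hom (prj g1) (prj rel_dim),
  forall v, l1 v *m dd v = phi v *m ll v.
Proof.
have /dependent_choice[L LE] : forall v, exists L, gens phi v *m ll v = L *m dd v.
  move=> v; apply/submxP/eps_sub; rewrite -mulmxA lift_eps mul_rowsub_mx phiy.
  by apply/matrixP => ? ?; rewrite !mxE.
exists (free_hom acyclic (prj rel_dim) L).
apply: (hom_ext acyclic (f := hom_comp dd (free_hom acyclic (prj rel_dim) L))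
   (h := hom_comp ll phi)) => u.
by rewrite -[LHS]mul_rowsub_mx -/(gens (free_hom _ _ _) u) gens_free_hom -LE
    mul_rowsub_mx.
Qed.

(** P(g0) + Q1 -> P(tau) is onto since y is, hence splits, P(tau) being free. *)
Lemma section_exists : exists (s0 : hom (prj tau) (prj g0)) (s1 : hom (prj tau)
    (prj rel_dim)),
  forall v, s0 v *m ll v - s1 v *m dd v = 1%:M.
Proof.
have /dependent_choice[L LE] : forall v, exists L, z v *m ll v - gin v = L *m dd v.
  move=> v; apply/submxP/eps_sub; rewrite mulmxBl -mulmxA lift_eps zy gin_mul.
  by rewrite gens_free_hom subrr.
set s0 := free_hom acyclic (prj g0) z; set s1 := free_hom acyclic (prj rel_dim) L.
exists s0, s1 => v; apply/eqP; rewrite subr_eq addrC; apply/eqP.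
apply: (hom_ext acyclic (f := hom_comp ll s0)
   (h := hom_add (hom_comp dd s1) (hom_id (prj tau)))) => u.
rewrite -[LHS]mul_rowsub_mx -/(gens s0 u) gens_free_hom.
rewrite [RHS](_ : _ = gens s1 u *m dd u + gin u); last first.
  by rewrite mul_rowsub_mx; apply/matrixP => i j; rewrite !mxE.
by rewrite gens_free_hom -LE subrK.
Qed.

(** The maps l1 : P(g1) -> Q1 and ll : P(g0) -> P(tau) form a morphism from phi to
    the resolution of Y. After adding the identity of Q1 to phi, they yield a
    subpresentation of phi + 1 with direct complements: the graph of l1 in
    P(g1) + Q1, mapped into the kernel of P(g0) + Q1 -> P(tau). Scaling this
    kernel by t and the graph by 1/t gives an orbit of phi + 1 which is polynomial
    in t, while f is multiplied by t to the power (dim of the kernel - dim of the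
    graph).beta = - <tau, beta> < 0, where dim counts generators, so f must
    vanish. *)
Lemma unstable_vanishes beta (f : projhom Q k (addv g0 rel_dim) (addv g1
    rel_dim) -> k) :
  semi_invariant (cvec int beta) f ->
  (\sum_v g0 v * beta v = \sum_v g1 v * beta v)%N ->
  (\sum_(a : arrow Q) tau (src a) * beta (tgt a) < \sum_v tau v * beta v)%N ->
  f (stab rel_dim phi) = 0.
Proof.
move=> [fp fsi] bal pos.
have [l1 l1E] := lift1_exists; have [s0 [s1 sE]] := section_exists.
pose q := rel_dim.
pose P := hom_add (hom_comp ll (lprj Q k g0 q)) (hom_scale (-1) (hom_comp dd
    (rprj Q k g0 q))).
pose s := hom_add (hom_comp (linj Q k g0 q) s0) (hom_comp (rinj Q k g0 q) s1).
pose gr := hom_add (linj Q k g1 q) (hom_comp (rinj Q k g1 q) l1).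
pose Phi := stab q phi.
have lP v : linj Q k g0 q v *m P v = ll v.
  rewrite /= mulmxDr -scalemxAr !mulmxA linj_lprj // linj_rprj //.
  by rewrite mul1mx mul0mx scaler0 addr0.
have rP v : rinj Q k g0 q v *m P v = - dd v.
  rewrite /= mulmxDr -scalemxAr !mulmxA rinj_lprj // rinj_rprj //.
  by rewrite mul1mx mul0mx add0r scaleN1r.
have sP v : s v *m P v = 1%:M.
  by rewrite mulmxDl -!mulmxA lP rP mulmxN sE.
have grl v : gr v *m lprj Q k g1 q v = 1%:M.
  by rewrite mulmxDl -mulmxA linj_lprj // rinj_lprj // mulmx0 addr0.
have grr v : gr v *m rprj Q k g1 q v = l1 v.
  by rewrite mulmxDl -mulmxA linj_rprj // rinj_rprj // mulmx1 add0r.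
have grP v : gr v *m Phi v *m P v = 0.
  have PhiE : Phi v = lprj Q k g1 q v *m phi v *m linj Q k g0 q v +
                      rprj Q k g1 q v *m rinj Q k g0 q v by [].
  rewrite PhiE mulmxDr mulmxDl -!mulmxA lP rP !mulmxA grl mul1mx.
  by rewrite !mulmxN grr l1E subrr.
(* The orbit is the line through Phi and Psi. *)
pose Psi := hom_add (hom_comp s (hom_comp P Phi)) (hom_comp Phi (hom_comp gr
    (lprj Q k g1 q))).
have [p pE] := polynomial_fun_line Phi Psi fp.
have line t : t != 0 -> t ^+ (\sum_v tau v * beta v - \sum_v q v * beta v)%N *
    p.[t] = f Phi.
  move=> t0; have t1 : t^-1 != 0 by rewrite invr_eq0.
  have := fsi (hom_scale t (idem_scale t^-1 P s)) (idem_scale t^-1 (lprj Q k g1 q) gr)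
    (hom_scale_aut t0 (idem_scale_aut sP t1)) (idem_scale_aut grl t1) Phi.
  rewrite chi_scale (chi_expn _ (fun v => det_diag_idem_scale acyclic _ _ sP)).
  rewrite (chi_expn _ (fun v => det_diag_idem_scale acyclic _ _ grl)).
  rewrite (polynomial_fun_ext (psi := hom_add (hom_scale t Phi) (hom_scale (1 -
      t) Psi)) fp).
    rewrite pE => ->; rewrite -/(rel_dim) -/q.
    rewrite -bal; set A := (\sum_v tau v * _)%N; set B := (\sum_v g0 v * _)%N.
    set C := (\sum_v q v * _)%N.
    have -> : (\sum_v addv g0 q v * beta v = B + C)%N.
      by rewrite -big_split; apply: eq_bigr => v _; rewrite mulnDl.
    have CA : (C <= A)%N by rewrite ltnW // /C sum_rel_dim.
    rewrite -[RHS]mul1r !mulrA; congr (_ * _).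
    rewrite -exprD addnC -addnA subnKC // !exprVn addnC exprD.
    by rewrite -mulrA mulrACA !mulfV ?expf_neq0 ?mulr1.
  move=> v; set c := t^-1 - 1.
  have tc : t * c = 1 - t by rewrite mulrBr mulfV // mulr1.
  pose l := lprj Q k g1 q v.
  transitivity ((1%:M + c *: (l *m gr v)) *m Phi v *m
                (t *: (1%:M + c *: (P v *m s v)))); first by [].
  transitivity (t *: Phi v + (1 - t) *: (Phi v *m P v *m s v + l *m gr v *m Phi v));
    last by [].
  rewrite -tc -(mulmxA (Phi v)); apply: sandwich_scale.
  by rewrite -!mulmxA (mulmxA (Phi v)) (mulmxA (gr v)) (mulmxA (gr v)) grP
      mul0mx mulmx0.
apply: (constant_vanishes (m := \sum_v tau v * beta v - \sum_v q v * beta v) _ line).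
by rewrite subn_gt0 sum_rel_dim.
Qed.

End HilbertMumford.
End SemiInvariants.

(** * Determinantal semi-invariants *)

Section Determinants.
Variable F : fieldType.

(** In a nonzero product over a permutation s no index goes down, and the total
    of h is preserved, so h is preserved at each index. *)
Lemma det_graded N (A : 'M[F]_N) (h : 'I_N -> nat) :
  (forall i j, A i j != 0 -> (h i <= h j)%N) ->
  \det A = \det (\matrix_(i, j) if h i == h j then A i j else 0).
Proof.
move=> hA; apply: eq_bigr => s _; congr (_ * _).
have [hs|] := boolP [forall i, h i == h (s i)].
  by apply: eq_bigr => i _; rewrite mxE (forallP hs).
case/forallPn => i0 hi0.
have [As0|As] := boolP [exists i, A i (s i) == 0].
  have /existsP[i /eqP Ai0] := As0.
  by rewrite (bigD1 i) //= Ai0 mul0r (bigD1 i) //= mxE Ai0 if_same mul0r.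
case/negP: hi0; move/existsPn: As => As.
have le i : (h i <= h (s i))%N by apply/hA/As.
have : (\sum_i h i == \sum_i h (s i))%N.
  by apply/eqP; rewrite [LHS](reindex_inj (@perm_inj _ s)).
rewrite (bigD1 i0) //= [X in _ == X](bigD1 i0) //= eqn_leq => /andP[_ le'].
rewrite eqn_leq le /= leqNgt; apply/negP => lt.
move: le'; rewrite leqNgt -addSn => /negP; apply.
by apply: leq_add => //; apply: leq_sum.
Qed.

(** The matrix acts by 1 + X t on the rows of S t, which span independent
    subspaces, and trivially on a complement of their sum. *)
Lemma det_orthogonal_sum N (T : finType) (m : T -> nat)
    (R : forall t, 'M[F]_(N, m t)) (S : forall t, 'M[F]_(m t, N))
    (X : forall t, 'M[F]_(m t)) :
  (forall t, S t *m R t = 1%:M) ->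
  (forall t u, t != u -> S t *m R u = 0) ->
  \det (1%:M + \sum_t R t *m X t *m S t) = \prod_t \det (1%:M + X t).
Proof.
move=> SR SR0; rewrite -(big_enum _ _ _ (fun t => R t *m X t *m S t)).
rewrite -(big_enum _ _ _ (fun t => \det (1%:M + X t))) /=.
elim: (enum T) (enum_uniq T) => [|u s IH] /=.
  by rewrite !big_nil addr0 det1.
case/andP=> us /IH {}IH; rewrite !big_cons -{}IH.
have -> : \det (1%:M + X u) = \det (1%:M + R u *m X u *m S u).
  by rewrite det_sylvester mulmxA SR mul1mx.
rewrite -det_mulmx mulmxDl mul1mx mulmxDr mulmx1 [X in _ + (_ + X)](_ : _ = 0).
  by rewrite addr0 addrA addrAC.
rewrite mulmx_sumr big_seq big1 // => t ts; rewrite -!mulmxA (mulmxA (S u)) SR0.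
  by rewrite mul0mx !mulmx0.
by apply: contraNneq us => ->.
Qed.

(** Conjugate matrices of sizes which are equal only propositionally. *)
Lemma det_intertwined m n (A : 'M[F]_m) (B : 'M_n) (P : 'M_(m, n)) :
  m = n -> row_free P -> A *m P = P *m B -> \det A = \det B.
Proof.
move=> mn; subst n; rewrite row_free_unit => uP E.
have := congr1 determinant E; rewrite !det_mulmx mulrC.
by apply: mulfI; rewrite -unitfE -unitmxE.
Qed.

Lemma det_through m n (A : 'M[F]_(m, n)) (B : 'M_n) (C : 'M_(n, m)) : m = n ->
  \det (A *m B *m C) = \det B * \det (A *m C).
Proof. by move=> mn; subst n; rewrite !det_mulmx mulrCA mulrA. Qed.

Section Families.
Variables (J1 J2 J3 : finType) (m1 n1 : J1 -> nat) (m2 n2 : J2 -> nat) (m3 n3 :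
    J3 -> nat).
Variables (L : mfam F m1 n1 -> mfam F m2 n2) (L' : mfam F m2 n2 -> mfam F m3 n3).
Hypothesis linL : flinear L.
Hypothesis linL' : flinear L'.

Lemma flinear_comp : flinear (fun x => L' (L x)).
Proof.
move=> c x y j; rewrite -linL'; congr (L' _ j).
by apply: functional_extensionality_dep => i; exact: linL.
Qed.

Lemma fmx_comp : fmx (fun x => L' (L x)) = fmx L *m fmx L'.
Proof.
apply/row_matrixP => i; rewrite !rowE mulmxA.
have E (r : 'rV[F]_#|fidx m1 n1|) : r = fvec (funvec r) by rewrite funvecK.
by rewrite (E (delta_mx ord0 i)) -(fmxE flinear_comp) -(fmxE linL) -(fmxE linL').
Qed.

End Families.

Lemma fmx_ext (J1 J2 : finType) (m1 n1 : J1 -> nat) (m2 n2 : J2 -> nat)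
    (L L' : mfam F m1 n1 -> mfam F m2 n2) : (forall x j, L x j = L' x j) ->
  fmx L = fmx L'.
Proof. by move=> E; apply/matrixP => i j; rewrite !fmx_entry E. Qed.

Lemma fmx_id (J : finType) (m n : J -> nat) : fmx (@id (mfam F m n)) = 1%:M.
Proof.
apply/row_matrixP => i; rewrite rowE.
have lin : flinear (@id (mfam F m n)) by [].
by rewrite -[delta_mx 0 i]funvecK -(fmxE lin) row1 -[RHS]funvecK.
Qed.

(** D j acts in the same way on each of the n j columns. *)
Lemma det_fmx_mul (J : finType) (m n : J -> nat) (D : forall j, 'M[F]_(m j)) :
  \det (fmx (fun (x : mfam F m n) j => D j *m x j)) = \prod_j \det (D j) ^+ n j.
Proof.
pose T : finType := {j : J & 'I_(n j)}.
(* R t selects the column tagged t of the component at tag t. *)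
pose R (t : T) : 'M[F]_(#|fidx m n|, m (tag t)) :=
  \matrix_(i, a) (enum_val i == Tagged (fun j => ('I_(m j) * 'I_(n j))%type)
      (a, tagged t))%:R.
have SR t : (R t)^T *m R t = 1%:M.
  apply/matrixP => a b; rewrite mxE (bigD1 (enum_rank (Tagged _ (a, tagged t) :
      fidx m n))) //=.
  rewrite big1 ?addr0 => [|i ia].
    by rewrite !mxE !enum_rankK eqxx mul1r eq_Tagged /= xpair_eqE eqxx andbT.
  rewrite !mxE; case: eqP => [E|]; last by rewrite mul0r.
  by case/eqP: ia; rewrite -E enum_valK.
have SR0 t u : t != u -> (R t)^T *m R u = 0.
  move=> tu; apply/matrixP => a b; rewrite !mxE big1 // => i _; rewrite !mxE.
  case: eqP => [->|]; last by rewrite mul0r.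
  case: eqP => [E|]; last by rewrite mulr0.
  case/eqP: tu; case: t u a b E => [j c] [j' c'] a b E.
  have /= jj := congr1 tag E; subst j'.
  by have /eqP := E; rewrite eq_Tagged /= xpair_eqE => /andP[_ /eqP->].
have xR x t : fvec x *m R t = (col (tagged t) (x (tag t)))^T.
  apply/rowP => a; rewrite mxE (bigD1 (enum_rank (Tagged _ (a, tagged t) : fidx
      m n))) //=.
  rewrite big1 ?addr0 => [|i ia]; first by rewrite !mxE !enum_rankK eqxx mulr1.
  rewrite !mxE; case: eqP => [E|]; last by rewrite mulr0.
  by case/eqP: ia; rewrite -E enum_valK.
have rS (t : T) (r : 'rV_(m (tag t))) (j : J) (a : 'I_(m j)) (c : 'I_(n j)) :
    (r *m (R t)^T) 0 (enum_rank (Tagged _ (a, c) : fidx m n)) =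
    \sum_b r 0 b * (Tagged (fun j => ('I_(m j) * 'I_(n j))%type) (a, c) ==
      Tagged (fun j => ('I_(m j) * 'I_(n j))%type) (b, tagged t) :> {j : J &
          ('I_(m j) * 'I_(n j))%type})%:R.
  by rewrite mxE; apply: eq_bigr => b _; rewrite !mxE enum_rankK.
have linD : flinear (fun (x : mfam F m n) j => D j *m x j).
  by move=> c x y j; rewrite mulmxDr -scalemxAr.
have -> : fmx (fun (x : mfam F m n) j => D j *m x j) =
    1%:M + \sum_(t : T) R t *m ((D (tag t))^T - 1%:M) *m (R t)^T.
  apply/row_matrixP => i; rewrite !rowE -[delta_mx 0 i]funvecK -(fmxE linD).
  set x := funvec _; rewrite mulmxDr mulmx1 mulmx_sumr.
  apply/rowP => l; rewrite -(enum_valK l); case: (enum_val l) => j [a c].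
  rewrite [RHS]mxE summxE (bigD1 (Tagged (fun j => 'I_(n j)) c : T)) // big1 ?addr0.
    rewrite !mulmxA xR rS /= (bigD1 a) //= eqxx mulr1 big1 ?addr0 => [|b ba];
        last first.
      by rewrite eq_Tagged /= xpair_eqE eq_sym (negPf ba) mulr0.
    rewrite mulmxBr mulmx1 -trmx_mul !mxE enum_rankK /= addrC subrK.
    by apply: eq_bigr => b _; rewrite !mxE.
  move=> t tc; rewrite mulmxA rS big1 // => b _; case: eqP => [E|]; last by
      rewrite mulr0.
  case/eqP: tc; case: t b E => j' c' b /= E; have /= jj := congr1 tag E; subst j'.
  by have /eqP := E; rewrite eq_Tagged /= xpair_eqE => /andP[_ /eqP->].
rewrite det_orthogonal_sum //.
rewrite (eq_bigr (fun t : T => \det (D (tag t)))); last first.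
  by move=> t _; rewrite addrC subrK det_tr.
rewrite -(sig_big_dep xpredT (fun j (_ : 'I_(n j)) => true) (fun j _ => \det (D
    j))) /=.
by apply: eq_bigr => j _; rewrite prodr_const card_ord.
Qed.

End Determinants.

Section DeterminantOfPull.
Variables (n : nat) (Q : quiver n) (k : fieldType).
Hypothesis acyclic : no_oriented_cycles Q.
Variables (beta : dimvec n) (M : rep Q k beta).
Local Notation prj := (@proj n Q k).
Local Notation pullM := (pull acyclic M).
Local Notation fidx g := (fidx (J := 'I_n) g beta).

Lemma fmx_pull_entry g0 g1 (phi : projhom Q k g0 g1)
    (v u : 'I_n) (i : 'I_(g0 v)) (j : 'I_(beta v)) (l : 'I_(g1 u)) (m : 'I_(beta u)) :
  fmx (pullM phi) (enum_rank (Tagged _ (i, j) : fidx g0)) (enum_rank (Tagged _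
      (l, m) : fidx g1)) =
  \sum_(b : pbasis Q g0 u) phi u (enum_rank (pgen Q l)) (enum_rank b) *
    free_hom acyclic M (funvec (delta_mx 0 (enum_rank (Tagged _ (i, j) : fidx
        g0)))) u (enum_rank b) m.
Proof.
rewrite fmx_entry enum_rankK /= mxE.
rewrite (reindex (fun b : pbasis Q g0 u => enum_rank b : 'I_(pdim Q g0 u))) /=.
  by apply: eq_bigr => b _; rewrite !mxE.
by exists enum_val => b _; rewrite ?enum_rankK ?enum_valK.
Qed.

(** A morphism which is zero on all generators but one is zero on the basis
    elements that start at another generator. *)
Lemma free_hom_delta g (v u : 'I_n) (i : 'I_(g v)) (j : 'I_(beta v)) (b :
    pbasis Q g u) :
  (val b).1 != Tagged (fun v => 'I_(g v)) i ->
  row (enum_rank b) (free_hom acyclic M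
    (funvec (delta_mx 0 (enum_rank (Tagged _ (i, j) : fidx g)))) u) = 0.
Proof.
move: u b; apply: (pbasis_ind (acyclic := acyclic)) => [u l ne|a b IH].
  rewrite -row_gens gens_free_hom; apply/rowP => m; rewrite !mxE /=.
  rewrite (inj_eq enum_rank_inj); case: eqP => // E.
  case/eqP: ne; rewrite /=; have /= uv := congr1 tag E; subst u.
  by have /eqP := E; rewrite eq_Tagged /= xpair_eqE => /andP[/eqP->].
by rewrite (pextE acyclic b).1 -(proj_row acyclic) homP row_mul => /IH ->;
    rewrite mul0mx.
Qed.

Lemma free_hom_delta0 g (v u : 'I_n) (i : 'I_(g v)) (j : 'I_(beta v)) (b :
    pbasis Q g u) m :
  (val b).1 != Tagged (fun v => 'I_(g v)) i ->
  free_hom acyclic M (funvec (delta_mx 0 (enum_rank (Tagged _ (i, j) : fidx g)))) u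
    (enum_rank b) m = 0.
Proof. by move=> /free_hom_delta-/(_ j)/rowP/(_ m); rewrite !mxE. Qed.

(** Paths go upwards with respect to [height], so that Hom(h, M) is block
    triangular; its diagonal block at v consists of beta v copies of the diagonal
    block of h, as the only path from v to v is trivial. *)
Lemma det_pull g (h : hom (prj g) (prj g)) :
  \det (fmx (pullM h)) = chi (cvec int beta) h.
Proof.
rewrite (det_graded (h := fun i => height Q (tag (enum_val i)))) => [|i j];
    last first.
  rewrite -(enum_valK i) -(enum_valK j) !enum_rankK.
  case: (enum_val i) (enum_val j) => [v [i1 i2]] [u [j1 j2]] /=.
  rewrite fmx_pull_entry; apply: contraNT; rewrite -ltnNge => lt.
  rewrite big1 // => b _.
  rewrite free_hom_delta0 ?mulr0 //.
  apply/eqP => E; have := valP b; rewrite /= E /= => /height_qpath - /(_ acyclic).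
  by move: lt; rewrite ltnNge => /negP lt le; apply: lt; apply: leq_trans
      (leq_addr _ _) le.
rewrite (_ : \matrix_(_, _) _ = fmx (fun (x : mfam k g beta) v => diag_block h
    v *m x v)).
  rewrite det_fmx_mul /chi; apply: eq_bigr => v _.
  by rewrite mxE natz -exprnP.
apply/matrixP => i j; rewrite mxE fmx_entry.
rewrite -(enum_valK i) -(enum_valK j) !enum_rankK.
case: (enum_val i) (enum_val j) => [v [i1 i2]] [u [j1 j2]] /=.
have diagE : (diag_block h u *m funvec (delta_mx 0 (enum_rank (Tagged _ (i1,
    i2) : fidx g))) u) j1 j2 =
   \sum_l h u (enum_rank (pgen Q j1)) (enum_rank (pgen Q l)) *
     (Tagged (fun v => ('I_(g v) * 'I_(beta v))%type) (i1, i2) == Tagged (fun v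
         => ('I_(g v) * 'I_(beta v))%type) (l, j2) :> {v : 'I_n & ('I_(g v) *
             'I_(beta v))%type})%:R.
  rewrite mxE; apply: eq_bigr => l _; rewrite !mxE eqxx /= (inj_eq enum_rank_inj).
  by rewrite eq_sym.
rewrite diagE fmx_pull_entry.
have [uv|uv] := eqVneq u v; last first.
  rewrite [RHS]big1 => [|l _]; last first.
    case: eqP => [E|]; last by rewrite mulr0.
    by have /= E' := congr1 tag E; rewrite E' eqxx in uv.
  case: eqP => // hE; rewrite big1 // => b _.
  rewrite free_hom_delta0 ?mulr0 //.
  apply/eqP => E; have hb := valP b; rewrite /= E /= in hb.
  have := height_qpath acyclic hb; rewrite hE -[X in (_ <= X)%N]addn0 leq_add2l leqn0.
  move/eqP/size0nil => p0; rewrite p0 /= in hb.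
  by rewrite (eqP hb) eqxx in uv.
subst u; rewrite eqxx.
rewrite (bigD1 (pgen Q i1)) //= [X in _ + X]big1 => [|b bi]; last first.
  rewrite free_hom_delta0 ?mulr0 //.
  apply: contra bi => /eqP E; apply/eqP/pbasis_eq => //=.
  by apply: acyclic (v) _ _; have := valP b; rewrite /= E.
rewrite [RHS](bigD1 i1) //= [X in _ = _ + X]big1 => [|l li]; last first.
  by rewrite eq_Tagged /= xpair_eqE eq_sym (negPf li) mulr0.
rewrite !addr0; congr (_ * _).
have := row_gens (free_hom acyclic M (funvec (delta_mx 0 (enum_rank (Tagged _
    (i1, i2) : fidx g))))) i1.
rewrite gens_free_hom => /rowP/(_ j2); rewrite !mxE => <-.
by rewrite eqxx /= (inj_eq enum_rank_inj) eq_sym.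
Qed.

End DeterminantOfPull.

Section StabilizedPull.
Variables (n : nat) (Q : quiver n) (k : fieldType).
Hypothesis acyclic : no_oriented_cycles Q.
Variables (beta : dimvec n) (M : rep Q k beta).
Local Notation pullM := (pull acyclic M).

Definition lpart (g d : dimvec n) (x : fam k (addv g d) beta) : fam k g beta :=
  fun v => rowsub (fun j => lshift (d v) j) (x v).
Definition rpart (g d : dimvec n) (x : fam k (addv g d) beta) : fam k d beta :=
  fun v => rowsub (fun j => rshift (g v) j) (x v).

Lemma parts_eq g d (x y : fam k (addv g d) beta) :
  lpart x = lpart y -> rpart x = rpart y -> x = y.
Proof.
move=> E1 E2; apply: functional_extensionality_dep => v.
apply/row_matrixP => i; case: (splitP i) => j ij.
  have -> : i = lshift (d v) j by apply: val_inj.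
  have := congr1 (fun z : fam k g beta => row j (z v)) E1.
  by rewrite !row_rowsub.
have -> : i = rshift (g v) j by apply: val_inj.
have := congr1 (fun z : fam k d beta => row j (z v)) E2.
by rewrite !row_rowsub.
Qed.

Lemma linj_free g d (x : fam k (addv g d) beta) v :
  linj Q k g d v *m free_hom acyclic M x v = free_hom acyclic M (lpart x) v.
Proof.
apply: (hom_ext acyclic (f := hom_comp (free_hom acyclic M x) (linj Q k g d))) => u.
rewrite -[LHS]mul_rowsub_mx -/(gens (linj Q k g d) u) gens_linj gens_free_hom.
rewrite mul_rowsub_mx mul1mx /lpart -(gens_free_hom acyclic M x u).
by apply/matrixP => i j; rewrite !mxE.
Qed.

Lemma rinj_free g d (x : fam k (addv g d) beta) v :
  rinj Q k g d v *m free_hom acyclic M x v = free_hom acyclic M (rpart x) v.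
Proof.
apply: (hom_ext acyclic (f := hom_comp (free_hom acyclic M x) (rinj Q k g d))) => u.
rewrite -[LHS]mul_rowsub_mx -/(gens (rinj Q k g d) u) gens_rinj gens_free_hom.
rewrite mul_rowsub_mx mul1mx /rpart -(gens_free_hom acyclic M x u).
by apply/matrixP => i j; rewrite !mxE.
Qed.

Lemma stab_free g0 g1 d (phi : projhom Q k g0 g1) (x : fam k (addv g0 d) beta) v :
  stab d phi v *m free_hom acyclic M x v =
  lprj Q k g1 d v *m (phi v *m free_hom acyclic M (lpart x) v) +
  rprj Q k g1 d v *m free_hom acyclic M (rpart x) v.
Proof.
by rewrite -linj_free -rinj_free !mulmxA -mulmxDl.
Qed.

Lemma pull_stab_l g0 g1 d (phi : projhom Q k g0 g1) x :
  lpart (pullM (stab d phi) x) = pullM phi (lpart x).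
Proof.
apply: functional_extensionality_dep => v.
rewrite [LHS](_ : _ = rowsub (fun i : 'I_(g1 v) =>
  enum_rank (pgen Q (lshift (d v) i : 'I_(addv g1 d v))) : 'I_(pdim Q (addv g1 d) v))
  (stab d phi v *m free_hom acyclic M x v)); last first.
  by apply/matrixP => i j; rewrite !mxE; apply: eq_bigr => l _; rewrite !mxE.
rewrite stab_free.
rewrite linearD /= -!mul_rowsub_mx lgen_lprj // lgen_rprj // mul0mx addr0.
rewrite mulmxA; congr (_ *m _).
by rewrite mul_rowsub_mx; congr (rowsub _ _); apply: mul1mx.
Qed.

Lemma pull_stab_r g0 g1 d (phi : projhom Q k g0 g1) x :
  rpart (pullM (stab d phi) x) = rpart x.
Proof.
apply: functional_extensionality_dep => v.
rewrite [LHS](_ : _ = rowsub (fun i : 'I_(d v) =>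
  enum_rank (pgen Q (rshift (g1 v) i : 'I_(addv g1 d v))) : 'I_(pdim Q (addv g1 d) v))
  (stab d phi v *m free_hom acyclic M x v)); last first.
  by apply/matrixP => i j; rewrite !mxE; apply: eq_bigr => l _; rewrite !mxE.
rewrite stab_free.
rewrite linearD /= -!mul_rowsub_mx rgen_lprj // rgen_rprj // mul0mx add0r.
rewrite -(gens_free_hom acyclic M (rpart x) v).
by rewrite mul_rowsub_mx; congr (rowsub _ _); apply: mul1mx.
Qed.

End StabilizedPull.

Section Matching.
Variables (n : nat) (k : fieldType) (beta : dimvec n).
Variables (p m : dimvec n) (T : fam k m beta -> fam k p beta).
Hypothesis linT : flinear T.

(** Zero outside the range; an index in nat makes sense for all g at once. *)
Definition nrow g (y : fam k g beta) v (l : nat) : 'rV[k]_(beta v) :=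
  if insub l is Some i then row (i : 'I_(g v)) (y v) else 0.

Lemma nrow_ord g (y : fam k g beta) v (i : 'I_(g v)) : nrow y v i = row i (y v).
Proof. by rewrite /nrow valK. Qed.

Lemma nrow_linear g c (x y : fam k g beta) v l :
  nrow (fun i => c *: x i + y i) v l = c *: nrow x v l + nrow y v l.
Proof.
rewrite /nrow; case: insubP => [i _ _|_]; last by rewrite scaler0 addr0.
by rewrite linearD linearZ.
Qed.

Definition truncate g (y : fam k g beta) : fam k m beta :=
  fun v => \matrix_(l < m v) nrow y v l.

(** To take the determinant of Hom(psi, M), its source, the families over
    g0 = g1 + p - m, has to be identified with its target, the families over g1.
    The copies added by stabilization come last, so copies are matched by their
    distance from the end; the first p and the first m copies are left over and
    are identified by T. This makes the determinants compatible with
    stabilization, without signs. *)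
Definition matching g0 g1 (y : fam k g1 beta) : fam k g0 beta :=
  fun v => \matrix_(i < g0 v)
    if (i < p v)%N then nrow (T (truncate y)) v i else nrow y v (i + m v - p v).

Lemma matching_flinear g0 g1 : flinear (@matching g0 g1).
Proof.
move=> c x y v; apply/row_matrixP => i; rewrite linearD linearZ /= !rowK.
have -> : truncate (fun u => c *: x u + y u) = fun u => c *: truncate x u +
    truncate y u.
  apply: functional_extensionality_dep => u; apply/row_matrixP => l.
  by rewrite linearD linearZ /= !rowK nrow_linear.
case: ifP => _; last exact: nrow_linear.
rewrite -nrow_linear; congr (nrow _ v i).
by apply: functional_extensionality_dep => u; apply: linT.
Qed.

Lemma nrow_lpart g d (y : fam k (addv g d) beta) v l : (l < g v)%N ->
  nrow (lpart y) v l = nrow y v l.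
Proof.
move=> lg; have lgd : (l < addv g d v)%N by apply: leq_trans lg (leq_addr _ _).
rewrite -[l]/(nat_of_ord (Ordinal lg)) nrow_ord row_rowsub.
exact/esym/(@nrow_ord (addv g d) y v (lshift (d v) (Ordinal lg))).
Qed.

Lemma matching_l g0 g1 d y : (forall v, g0 v + m v = g1 v + p v)%N -> (forall
    v, m v <= g1 v)%N ->
  lpart (@matching (addv g0 d) (addv g1 d) y) = @matching g0 g1 (lpart y).
Proof.
move=> gE mg; apply: functional_extensionality_dep => v; apply/row_matrixP => i.
rewrite row_rowsub !rowK /=.
have -> : truncate (lpart y) = truncate y.
  apply: functional_extensionality_dep => u; apply/row_matrixP => l; rewrite !rowK.
  by apply: nrow_lpart; apply: leq_trans (mg u).
case: ifP => // ip; rewrite nrow_lpart //.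
by have := ltn_ord i; have := gE v; lia.
Qed.

Lemma matching_r g0 g1 d y : (forall v, g0 v + m v = g1 v + p v)%N -> (forall
    v, p v <= g0 v)%N ->
  rpart (@matching (addv g0 d) (addv g1 d) y) = rpart y.
Proof.
move=> gE pg; apply: functional_extensionality_dep => v; apply/row_matrixP => i.
rewrite !row_rowsub !rowK /= ltnNge (leq_trans (pg v)) ?leq_addr //=.
rewrite (_ : _ - _ = rshift (g1 v) i)%N ?nrow_ord //=.
by have := gE v; lia.
Qed.

Lemma matching_id y : @matching p m y = T y.
Proof.
apply: functional_extensionality_dep => v; apply/row_matrixP => i.
rewrite rowK ltn_ord nrow_ord; congr (row i (T _ v)).
apply: functional_extensionality_dep => u; apply/row_matrixP => l.
by rewrite rowK nrow_ord.
Qed.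

End Matching.

Section DeterminantalInvariant.
Variables (n : nat) (Q : quiver n) (k : fieldType).
Hypothesis acyclic : no_oriented_cycles Q.
Variables (beta : dimvec n) (M : rep Q k beta).
Local Notation pullM := (pull acyclic M).
Local Notation fidx g := (fidx (J := 'I_n) g beta).

(** The entries of Hom(psi, M) are linear in the coordinates of psi. *)
Lemma pull_polynomial g0 g1 (X : 'M[k]_(#|fidx g1|, #|fidx g0|)) :
  polynomial_fun (fun phi : projhom Q k g0 g1 => \det (X *m fmx (pullM phi))).
Proof.
pose C := {v : 'I_n & ('I_(pdim Q g1 v) * 'I_(pdim Q g0 v))%type}.
pose e (i : 'I_#|fidx g0|) : fam k g0 beta := funvec (delta_mx 0 i).
pose P : 'M[{mpoly k[#|{: C}|]}]_(#|fidx g0|, #|fidx g1|) := \matrix_(i, j)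
  let c := enum_val j in
  \sum_b (free_hom acyclic M (e i) (tag c) b (tagged c).2) *:
    'X_(enum_rank (Tagged (fun v => ('I_(pdim Q g1 v) * 'I_(pdim Q g0 v))%type)
      (enum_rank (pgen Q (tagged c).1) : 'I_(pdim Q g1 (tag c)), b) : C)).
exists (\det (map_mx (fun c => c%:MP) X *m P)) => phi.
rewrite -[RHS](det_map_mx (meval (hom_coord phi))); congr (\det _).
rewrite map_mxM; congr (_ *m _).
  by apply/matrixP => i j; rewrite !mxE; apply/esym/mevalC.
apply/matrixP => i j; rewrite fmx_entry [LHS]mxE [RHS]mxE [P i j]mxE
    [RHS]raddf_sum /=.
by apply: eq_bigr => b _; rewrite mevalZ mevalXU /hom_coord enum_rankK /= !mxE mulrC.
Qed.

Variables (p m : dimvec n) (phi : projhom Q k p m).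
Hypothesis pm0 : forall v, (p v == 0%N) || (m v == 0%N).
Hypothesis balanced : (\sum_v p v * beta v = \sum_v m v * beta v)%N.
Hypothesis phi_inj : forall x, (forall v, pullM phi x v = 0) -> forall v, x v = 0.

Lemma pull_inverse : exists T : fam k m beta -> fam k p beta,
  flinear T /\ forall y, pullM phi (T y) = y.
Proof.
have surj := flinear_inj_surj (pull_flinear acyclic M phi) balanced phi_inj.
have /dependent_choice[T TE] := surj.
exists T; split=> // c x y v.
apply: subr0_eq.
apply: (phi_inj (x := fun v => T (fun i => c *: x i + y i) v -
   (c *: T x v + T y v))) => u.
have -> : (fun v => T (fun i => c *: x i + y i) v - (c *: T x v + T y v)) =
   (fun v => (-1) *: (fun v => c *: T x v + T y v) v + T (fun i => c *: x i + y i) v).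
  by apply: functional_extensionality_dep => w; rewrite scaleN1r addrC.
rewrite pull_flinear TE pull_flinear !TE scaleN1r addNr //.
Qed.

(** The family of the determinants of Hom(psi, M), normalized to be 1 at phi. *)
Lemma determinant_in_support (alpha : 'cV[int]_n) :
  (euler_mx Q)^T *m alpha = cvec int p - cvec int m ->
  supp_int Q k beta alpha.
Proof.
move=> alphaE; have [T [linT TE]] := pull_inverse.
have pdE (x : projdec Q alpha) v : (pd0 x v + m v = pd1 x v + p v)%N.
  case: x => g0 g1 /= /eqP; rewrite alphaE => /matrixP/(_ v ord0).
  by rewrite !mxE !natz; lia.
have pd_p (x : projdec Q alpha) v : (p v <= pd0 x v)%N.
  by have := pdE x v; case/orP: (pm0 v) => /eqP ->; lia.
have pd_m (x : projdec Q alpha) v : (m v <= pd1 x v)%N.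
  by have := pdE x v; case/orP: (pm0 v) => /eqP ->; lia.
have card_pd (x : projdec Q alpha) : #|fidx (pd1 x)| = #|fidx (pd0 x)|.
  rewrite !card_fidx; have := balanced.
  have : (\sum_v pd0 x v * beta v + \sum_v m v * beta v =
          \sum_v pd1 x v * beta v + \sum_v p v * beta v)%N.
    by rewrite -!big_split /=; apply: eq_bigr => v _; rewrite -!mulnDl pdE.
  by move=> E1 E2; rewrite E2 in E1; move/addIn: E1 => ->.
pose Theta (x : projdec Q alpha) := fun y => matching T (pd0 x) (g1 := pd1 x) y.
have linTheta x : flinear (Theta x) by apply: matching_flinear.
pose f (x : projdec Q alpha) (psi : projhom Q k (pd0 x) (pd1 x)) :=
  \det (fmx (fun y => pullM psi (Theta x y))).
have fE x psi : f x psi = \det (fmx (Theta x) *m fmx (pullM psi)).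
  by rewrite -fmx_comp //; apply: pull_flinear.
exists f.
  split=> [x|x d psi].
    split.
      have [q qE] := pull_polynomial (fmx (Theta x)).
      by exists q => psi; rewrite fE qE.
    move=> h0 h1 _ _ psi; rewrite !fE.
    have -> : fmx (pullM (hom_comp h0 (hom_comp psi h1))) =
        fmx (pullM h0) *m fmx (pullM psi) *m fmx (pullM h1).
      rewrite -!fmx_comp; try exact: pull_flinear.
        by apply: fmx_ext => y v; rewrite !pull_comp; congr (_ *m _);
          congr (free_hom _ _ _ v); apply: functional_extensionality_dep => u;
          rewrite pull_comp.
      by apply: flinear_comp; apply: pull_flinear.
    rewrite !mulmxA det_mulmx det_pull // -mulmxA mulmxA det_through //.
    by rewrite det_pull // mulrAC.
  set E := fun y => pullM (stab d psi) (Theta (pd_shift x d) y).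
  have linE : flinear E by apply: flinear_comp => //; apply: pull_flinear.
  have linE0 : flinear (fun y => pullM psi (Theta x y)).
    by apply: flinear_comp => //; apply: pull_flinear.
  have linl : flinear (@lpart n k beta (pd1 x) d).
    by move=> c y z v; apply/matrixP => i j; rewrite !mxE.
  have linr : flinear (@rpart n k beta (pd1 x) d).
    by move=> c y z v; apply/matrixP => i j; rewrite !mxE.
  pose P := row_mx (fmx (@lpart n k beta (pd1 x) d)) (fmx (@rpart n k beta (pd1
      x) d)).
  pose B := block_mx (fmx (fun y => pullM psi (Theta x y))) 0 0
    (1%:M : 'M_#|fidx d|).
  (* The operator of the stabilization is that of psi on the old copies and the
   identity on the new ones. *)
have El y : lpart (E y) = pullM psi (Theta x (lpart y)).
    by rewrite pull_stab_l matching_l.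
  have Er y : rpart (E y) = rpart y by rewrite pull_stab_r matching_r.
  rewrite /f -[RHS]mulr1 -[X in _ = _ * X](det1 k #|fidx d|) -(det_ublock _ 0) -/B.
  apply: (det_intertwined (P := P)).
  - rewrite !card_fidx -big_split /=; apply: eq_bigr => v _.
    by rewrite /addv mulnDl.
  - apply/inj_row_free => r rP0; rewrite -[r]funvecK; apply/rowP => i.
    suff -> : funvec r = fun v => 0 by rewrite !mxE.
    move: rP0; rewrite mul_mx_row -[r]funvecK -(fmxE linl) -(fmxE linr) funvecK.
    rewrite -row_mx0 => /eq_row_mx[l0 r0]; apply: parts_eq.
      rewrite -[LHS]fvecK l0; apply: functional_extensionality_dep => v.
      by apply/matrixP => ? ?; rewrite !mxE.
    rewrite -[LHS]fvecK r0; apply: functional_extensionality_dep => v.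
    by apply/matrixP => ? ?; rewrite !mxE.
  rewrite mul_mx_row mul_row_block !mulmx0 mulmx1 addr0 add0r -!fmx_comp //.
  by congr row_mx; apply: fmx_ext => y v; rewrite ?El ?Er.
have E0 : (euler_mx Q)^T *m alpha == cvec int p - cvec int m by rewrite alphaE.
exists (ProjDec E0), phi.
rewrite /f (_ : fmx _ = 1%:M) ?det1 ?oner_neq0 // -fmx_id.
by apply: fmx_ext => y v; rewrite /Theta matching_id TE.
Qed.

End DeterminantalInvariant.

(** * The generic pair of a presentation and a representation *)

Section GenericPair.
Variables (n : nat) (Q : quiver n).
Hypothesis acyclic : no_oriented_cycles Q.
Variables (g0 g1 beta : dimvec n).

Definition presentation_coord : finType :=
  {v : 'I_n & ('I_(g1 v) * 'I_(pdim Q g0 v))%type}.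
Definition module_coord : finType :=
  {a : arrow Q & ('I_(beta (src a)) * 'I_(beta (tgt a)))%type}.
Definition pair_coord : finType := (presentation_coord + module_coord)%type.

Definition gens_of (T : Type) (X : pair_coord -> T) v : 'M[T]_(g1 v, pdim Q g0 v) :=
  \matrix_(i, j) X (inl (Tagged (fun v => ('I_(g1 v) * 'I_(pdim Q g0 v))%type)
      (i, j))).
Definition module_of (T : Type) (X : pair_coord -> T) (a : arrow Q) :
    'M[T]_(beta (src a), beta (tgt a)) :=
  \matrix_(i, j) X (inr (Tagged (fun a : arrow Q =>
    ('I_(beta (src a)) * 'I_(beta (tgt a)))%type) (i, j))).

Lemma euler_framed (d : dimvec n) :
  euler_pair (frame_src (Q := Q)) (frame_tgt (Q := Q))
     (frame_dim (pdim Q g0) g1) (frame_dim d (fun=> 0%N)) =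
  (\sum_v g0 v * d v)%N%:Z - (\sum_v g1 v * d v)%N%:Z.
Proof.
rewrite /euler_pair !big_sumType /= pdim_euler // [X in (_ + X)%N%:Z - _]big1.
  by rewrite !PoszD; ring.
by move=> v _; rewrite muln0.
Qed.

Lemma euler_framed_op (d : 'I_n + 'I_n -> nat) : (forall v, d (inr v) = 0%N) ->
  euler_pair (frame_tgt (Q := Q)) (frame_src (Q := Q)) (frame_dim beta (fun=>
      0%N)) d =
  (\sum_v d (inl v) * beta v)%N%:Z -
  (\sum_(a : arrow Q) d (inl (src a)) * beta (tgt a))%N%:Z.
Proof.
move=> d0; rewrite /euler_pair !big_sumType /=.
rewrite [X in (_ + X)%N%:Z - _]big1 // [X in _ - (_ + X)%N%:Z]big1 => [|v _];
    last first.
  by rewrite d0 muln0.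
rewrite !addn0; congr (_ - _); congr (Posz _); apply: eq_bigr => i _; exact: mulnC.
Qed.

Section Values.
Variable R : idomainType.
Notation K := {fraction R}.
Variable X : pair_coord -> R.
Hypothesis derX : forall c : pair_coord -> K,
  exists D, derivation D /\ forall i, D (tofrac (X i)) = c i.
Notation KX := (fun i => tofrac (X i) : K).
Notation genericV := (framed (proj K g0) (gens_of KX)).
Notation genericW := (unframed (module_of KX : rep Q K beta)).

Lemma coordinates_generic : generic (gens_of KX) (module_of KX : rep Q K beta).
Proof.
move=> f' M'.
have [D [dD DX]] := derX (fun i => match i with
  | inl c => f' (tag c) (tagged c).1 (tagged c).2
  | inr c => M' (tag c) (tagged c).1 (tagged c).2 end).
by exists D; split=> // [v|a]; apply/matrixP => i j; rewrite !mxE DX.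
Qed.

Lemma pair_versal : versal genericV genericW.
Proof. exact: (generic_versal acyclic coordinates_generic). Qed.

Section At.
Variables (k : fieldType) (ev : {rmorphism R -> k}).
Notation kX := (fun i => ev (X i)).

Lemma genericV_value e : has_valuemx ev (genericV e) (framed (proj k g0)
    (gens_of kX) e).
Proof.
case: e => [a|v] i j; rewrite !mxE; first exact: has_value_nat.
exact: has_value_tofrac.
Qed.

Lemma genericW_value e : has_valuemx ev (genericW e)
  (unframed (module_of kX : rep Q k beta) e).
Proof.
case: e => [a|v] i j; rewrite !mxE; first exact: has_value_tofrac.
exact: (has_value_nat _ 0).
Qed.

End At.
End Values.

Section FramedHoms.
Variables (k : fieldType) (f : fam k g1 (pdim Q g0)) (M : rep Q k beta).

Lemma hom_zero_pull_inj : hom_zero (framed (proj k g0) f) (unframed M) ->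
  forall x, (forall v, pull acyclic M (free_hom acyclic (proj k g0) f) x v = 0) ->
  forall v, x v = 0.
Proof.
move=> h x x0 v; rewrite -(gens_free_hom acyclic M x v).
pose y (u : 'I_n + 'I_n) : 'M[k]_(frame_dim (pdim Q g0) g1 u, frame_dim beta
    (fun=> 0%N) u) :=
  match u with inl v => free_hom acyclic M x v | inr v => 0 end.
have y0 : forall u, y u = 0.
  apply: h => -[a|u] /=; first exact: homP.
  by have := x0 u; rewrite /pull gens_free_hom mul0mx.
have E : free_hom acyclic M x v = 0 := y0 (inl v).
by rewrite /gens E; apply/matrixP => ? ?; rewrite !mxE.
Qed.

End FramedHoms.

(** Hom(phi, M') is a restriction of Hom(phi, M) for a subrepresentation M'. *)
Lemma sub_dim_le (k : fieldType) (M : rep Q k beta) (phi : projhom Q k g0 g1)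
    (b : dimvec n) :
  (forall x, (forall v, pull acyclic M phi x v = 0) -> forall v, x v = 0) ->
  has_subrep M b -> (\sum_v g0 v * b v <= \sum_v g1 v * b v)%N.
Proof.
move=> inj [U [rU UM]].
pose d v := \rank (U v); pose B v := row_base (U v).
have /dependent_choice[M' M'E] : forall a, exists M', B (src a) *m M a = M' *m
    B (tgt a).
  move=> a; apply/submxP; rewrite eq_row_base; apply: submx_trans (UM a).
  by apply: submxMr; rewrite eq_row_base.
have homB : forall a, (M' a : 'M_(d (src a), d (tgt a))) *m B (tgt a) = B (src
    a) *m M a.
  by move=> a; rewrite M'E.
pose inc : hom (M' : rep Q k d) M := Defs.Hom homB.
have pullB x v : pull acyclic M phi (fun u => x u *m B u) v =
    pull acyclic (M' : rep Q k d) phi x v *m B v.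
  rewrite /pull -mulmxA; congr (_ *m _).
  apply/esym/(hom_ext acyclic (f := hom_comp inc (free_hom acyclic (M' : rep Q
      k d) x))) => u.
  by rewrite gens_free_hom -[LHS]mul_rowsub_mx -/(gens (free_hom _ _ _) u)
      gens_free_hom.
have -> : (\sum_v g0 v * b v = \sum_v g0 v * d v)%N.
  by apply: eq_bigr => v _; rewrite /d rU.
have -> : (\sum_v g1 v * b v = \sum_v g1 v * d v)%N.
  by apply: eq_bigr => v _; rewrite /d rU.
apply: (flinear_inj_leq (pull_flinear acyclic (M' : rep Q k d) phi)) => x x0 v.
apply: (row_free_inj (row_base_free (U v))); rewrite mul0mx.
apply: (inj (fun u => x u *m B u)) => u.
by rewrite pullB x0 mul0mx.
Qed.

End GenericPair.

Section EulerForm.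
Variables (n : nat) (Q : quiver n) (R : realType).

Lemma euler_form_presentation (alpha : 'cV[int]_n) (g0 g1 b : dimvec n) :
  (euler_mx Q)^T *m alpha = cvec int g0 - cvec int g1 ->
  euler_form Q (map_mx intr alpha) (cvec R b) =
  ((\sum_v g0 v * b v)%N%:Z - (\sum_v g1 v * b v)%N%:Z)%:~R.
Proof.
move=> E; rewrite /euler_form.
have -> : (map_mx intr alpha)^T *m map_mx intr (euler_mx Q) =
    (map_mx intr (cvec int g0 - cvec int g1))^T :> 'rV[R]_n.
  by rewrite -E map_mxM trmx_mul -map_trmx trmxK.
rewrite mxE intrB -!pmulrn !natr_sum -sumrB; apply: eq_bigr => v _.
by rewrite !mxE !natz intrB -!pmulrn !natrM mulrBl.
Qed.

End EulerForm.

Section Inclusions.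
Variables (n : nat) (Q : quiver n) (k : closedFieldType).
Hypothesis acyclic : no_oriented_cycles Q.
Variable beta : dimvec n.

Section Points.
Variables g0 g1 : dimvec n.
Notation C := (pair_coord Q g0 g1 beta).
Notation R := {mpoly k[#|C|]}.
Implicit Type pt : C -> k.

Definition var (c : C) : R := 'X_(enum_rank c).
Definition at_point pt : R -> k := meval (fun i => pt (enum_val i)).
HB.instance Definition _ pt := GRing.RMorphism.on (at_point pt).

Lemma at_pointM_neq0 pt p q :
  (at_point pt (p * q) != 0) = (at_point pt p != 0) && (at_point pt q != 0).
Proof. by rewrite /at_point mevalM mulf_eq0 negb_or. Qed.

Lemma at_point_var pt : (fun c => at_point pt (var c)) = pt.
Proof.
by apply: functional_extensionality_dep => c; rewrite /at_point mevalXU enum_rankK.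
Qed.

Lemma var_derivation (c : C -> {fraction R}) :
  exists D, derivation D /\ forall i, D (tofrac (var i)) = c i.
Proof.
have [D [dD DX]] := exists_derivation (fun i => c (enum_val i)).
by exists D; split=> // i; rewrite DX enum_rankK.
Qed.

Lemma nonzero_point (q : R) : q != 0 -> exists pt, at_point pt q != 0.
Proof.
move/mpoly_nonzero_at => [v qv]; exists (fun c => v (enum_rank c)).
rewrite /at_point (meval_eq (v2 := v)) // => i.
by rewrite enum_valK.
Qed.

Definition coord_point (f : fam k g1 (pdim Q g0)) (M : rep Q k beta) : C -> k :=
  fun c => match c with
  | inl c => f (tag c) (tagged c).1 (tagged c).2
  | inr c => M (tag c) (tagged c).1 (tagged c).2 end.

Lemma gens_of_coord_point f M : gens_of (coord_point f M) = f.
Proof.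
by apply: functional_extensionality_dep => v; apply/matrixP => i j; rewrite !mxE.
Qed.

Lemma module_of_coord_point f M : module_of (coord_point f M) = M.
Proof.
by apply: functional_extensionality_dep => v; apply/matrixP => i j; rewrite !mxE.
Qed.

Lemma coord_point_of pt : coord_point (gens_of pt) (module_of pt) = pt.
Proof.
apply: functional_extensionality_dep => -[c|c] /=; rewrite mxE.
  by case: c => v [].
by case: c => v [].
Qed.

Notation KX := (fun i => tofrac (var i) : {fraction R}).
Notation genericV := (framed (proj {fraction R} g0) (gens_of KX)).
Notation genericW := (unframed (module_of KX : rep Q {fraction R} beta)).

Lemma generic_pair_versal : versal genericV genericW.
Proof. exact: (pair_versal acyclic var_derivation). Qed.

Lemma genericV_at pt e :
  has_valuemx (at_point pt) (genericV e) (framed (proj k g0) (gens_of pt) e).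
Proof. by have := @genericV_value _ _ _ _ beta _ var _ (at_point pt) e; rewrite
    at_point_var. Qed.

Lemma genericW_at pt e : has_valuemx (at_point pt) (genericW e)
  (unframed (module_of pt : rep Q k beta) e).
Proof. by have := @genericW_value _ _ g0 g1 _ _ var _ (at_point pt) e; rewrite
    at_point_var. Qed.

Lemma pull_inj_at : hom_zero genericV genericW ->
  exists2 q : R, q != 0 & forall pt, at_point pt q != 0 ->
  forall x, (forall v, pull acyclic (module_of pt : rep Q k beta)
      (free_hom acyclic (proj k g0) (gens_of pt)) x v = 0) ->
    forall v, x v = 0.
Proof.
move=> /hom_zero_specialize[q q0 qP]; exists q => // pt qpt.
apply: hom_zero_pull_inj.
exact: (qP _ (at_point pt) _ _ qpt (@genericV_at pt) (@genericW_at pt)).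
Qed.

(** A subrepresentation of the generic M may involve the coordinates of the
    presentation; these are specialized to an arbitrary f, and the union over all
    f of the resulting open sets of M is open. *)
Lemma generic_sub_general (d : 'I_n + 'I_n -> nat)
    (U : fam {fraction R} d (frame_dim beta (fun=> 0%N)))
    (S : fam {fraction R} (frame_dim beta (fun=> 0%N)) d)
    (B : arrfam {fraction R} (frame_src (Q := Q)) (frame_tgt (Q := Q)) d d) :
  (forall v, U v *m S v = 1%:M) ->
  (forall e, U (frame_src e) *m genericW e = B e *m U (frame_tgt e)) ->
  general_sub Q k (fun v => d (inl v)) beta.
Proof.
move=> US UW; have [q q0 qP] := subrep_specialize US UW.
have sub f M : at_point (coord_point f M) q != 0 -> has_subrep M (fun v => d (inl v)).
  move=> qpt; have := qP _ (at_point (coord_point f M)) _ qpt (@genericW_at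
      (coord_point f M)).
  case=> U' [S' [B' [US' UB']]].
  exists (fun v => <<U' (inl v)>>%MS); split=> [v|a].
    rewrite mxrank_gen; apply/eqP; rewrite eqn_leq rank_leq_row /=.
    by rewrite -[X in (X <= _)%N](mxrank1 k) -(US' (inl v)) mxrankM_maxl.
  have := UB' (inl a); rewrite /= module_of_coord_point => E.
  rewrite genmxE (eqmxMr _ (genmxE _)) [X in (X <= _)%MS]E; exact: submxMl.
pose SU (r : {mpoly k[#|module_coord Q beta|]}) : Prop :=
  exists f, forall M : rep Q k beta, r.@[rep_coord M] = at_point (coord_point f M) q.
exists [set M : rep Q k beta | exists f, at_point (coord_point f M) q !=
    0]%classic; split.
- exists [set r | SU r]%classic => M; split=> [[f qf]|[r [f rf]]]; last first.
    by rewrite rf => qf; exists f.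
  pose lq := [tuple (match enum_val i with
    | inl c => (f (tag c) (tagged c).1 (tagged c).2)%:MP
    | inr c => 'X_(enum_rank c) end : {mpoly k[#|module_coord Q beta|]}) | i < #|C|].
  have E M' : (q \mPo lq).@[rep_coord M'] = at_point (coord_point f M') q.
    rewrite comp_mpoly_meval /at_point; apply: meval_eq => i.
    rewrite tnth_mktuple; case: (enum_val i) => c /=; first by rewrite mevalC.
    by rewrite mevalXU /rep_coord enum_rankK.
  by exists (q \mPo lq); [exists f | rewrite E].
- have [pt qpt] := nonzero_point q0.
  by exists (module_of pt), (gens_of pt); rewrite coord_point_of.
- by move=> M [f]; apply: sub.
Qed.

End Points.

Lemma domain_in_support (alpha : 'cV[int]_n) (g0 g1 : dimvec n) :
  (euler_mx Q)^T *m alpha = cvec int g0 - cvec int g1 ->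
  (forall v, (g0 v == 0%N) || (g1 v == 0%N)) ->
  (\sum_v g0 v * beta v = \sum_v g1 v * beta v)%N ->
  (forall b, general_sub Q k b beta -> (\sum_v g0 v * b v <= \sum_v g1 v * b v)%N) ->
  supp_int Q k beta alpha.
Proof.
move=> alphaE min bal sub_le.
have hz := versal_hom_zero (generic_pair_versal (g0 := g0) (g1 := g1)).
have [||q q0 qP] := pull_inj_at (hz _ _).
- by rewrite euler_framed // bal subrr.
- move=> d U S B US UW _.
  have dr v : d (inr v) = 0%N.
    apply/eqP; rewrite -leqn0 -[X in (X <= _)%N](mxrank1 {fraction {mpoly
        k[#|pair_coord Q g0 g1 beta|]}}).
    by rewrite -(US (inr v)); apply: leq_trans (mxrankM_maxl _ _) (rank_leq_col _).
  have le := sub_le _ (generic_sub_general US UW).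
  have -> : d = frame_dim (fun v => d (inl v)) (fun=> 0%N).
    by apply: functional_extensionality_dep => -[v|v] //=.
  by rewrite euler_framed // subr_le0.
have [pt qpt] := nonzero_point q0.
exact: (determinant_in_support (acyclic := acyclic) min bal (qP pt qpt) alphaE).
Qed.

End Inclusions.

(** * Semi-invariants and the domain D(beta) *)

Section Converse.
Variables (n : nat) (Q : quiver n) (k : closedFieldType).
Hypothesis acyclic : no_oriented_cycles Q.
Variable beta : dimvec n.

Section Points.
Variables g0 g1 : dimvec n.
Notation C := (pair_coord Q g0 g1 beta).
Notation R := {mpoly k[#|C|]}.

Lemma invariant_at_point (f : projhom Q k g0 g1 -> k) : polynomial_fun f ->
  exists q : R, forall pt : C -> k,
    at_point pt q = f (free_hom acyclic (proj k g0) (gens_of pt)).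
Proof.
case=> p fp.
pose L (x : fam k g1 (pdim Q g0)) : fam k (pdim Q g1) (pdim Q g0) :=
  fun v => free_hom acyclic (proj k g0) x v.
have linL : flinear L by move=> c x y v; apply: free_hom_linear.
pose lq := [tuple \sum_j (fmx L j i) *: var k (inl (enum_val j) : C) | i < _].
exists (p \mPo lq) => pt; rewrite fp /at_point comp_mpoly_meval; apply: meval_eq => i.
rewrite tnth_mktuple raddf_sum /=.
have -> : hom_coord (free_hom acyclic (proj k g0) (gens_of pt)) i = fvec (L
    (gens_of pt)) 0 i.
  by rewrite mxE.
rewrite fmxE // mxE; apply: eq_bigr => j _.
rewrite mevalZ mulrC /var mevalXU enum_rankK !mxE; congr (pt (inl _) * _).
by case: (enum_val j) => v [].
Qed.

Lemma open_at_point (r : {mpoly k[#|module_coord Q beta|]}) :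
  exists q : R, forall pt : C -> k,
    at_point pt q = r.@[rep_coord (module_of pt : rep Q k beta)].
Proof.
pose lq := [tuple var k (inr (enum_val i) : C) | i < #|module_coord Q beta|].
exists (r \mPo lq) => pt; rewrite /at_point comp_mpoly_meval; apply: meval_eq => i.
rewrite tnth_mktuple /var mevalXU enum_rankK /rep_coord mxE; congr (pt (inr _)).
by case: (enum_val i) => a [].
Qed.

End Points.

(** The quotients of the framed P(g0) that the transposed criterion has to bound
    are zero on the framing, hence are quotients Y of the cokernel of the generic
    presentation. If <dim Y, beta> > 0, then specializing Y at a point where f is
    not zero contradicts [unstable_vanishes]. *)
Lemma invariant_hom_zero (alpha : 'cV[int]_n) f (x : projdec Q alpha) phi :
  @virtual_semi_invariant n Q k alpha (cvec int beta) f -> f x phi != 0 ->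
  let K := {fraction {mpoly k[#|pair_coord Q (pd0 x) (pd1 x) beta|]}} in
  let KX := fun i => tofrac (var k i) : K in
  hom_zero (framed (proj K (pd0 x)) (gens_of KX))
           (unframed (module_of KX : rep Q K beta)).
Proof.
move=> [fsi fstab] fx0 K KX.
have bal := semi_invariant_balanced (fsi x) fx0.
apply: hom_zero_tr; apply: versal_hom_zero.
- exact/versal_tr/generic_pair_versal.
- have -> : euler_pair (frame_tgt (Q := Q)) (frame_src (Q := Q)) (frame_dim
    beta (fun=> 0%N))
     (frame_dim (pdim Q (pd0 x)) (pd1 x)) =
     euler_pair (frame_src (Q := Q)) (frame_tgt (Q := Q)) (frame_dim (pdim Q
         (pd0 x)) (pd1 x))
       (frame_dim beta (fun=> 0%N)).
    rewrite /euler_pair; congr (_ - _); congr (Posz _); apply: eq_bigr => i _;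
        exact: mulnC.
  by rewrite euler_framed // bal subrr.
move=> d U S B US UW d0; rewrite leNgt; apply/negP => pos.
have [q q0 qP] := subrep_specialize US UW.
have [r rE] := invariant_at_point (fsi x).1.
have r0 : r != 0.
  apply: contraNneq fx0 => r0.
  have := rE (coord_point (fun v => gens phi v) (fun a => 0)).
  rewrite r0 /at_point meval0 gens_of_coord_point => /esym E.
  apply/eqP; rewrite -[RHS]E; apply: polynomial_fun_ext (fsi x).1 _.
  by apply: (hom_ext acyclic) => v; rewrite gens_free_hom.
have [pt] := nonzero_point (mulf_neq0 q0 r0).
rewrite at_pointM_neq0 => /andP[qpt]; rewrite rE.
set psi := free_hom _ _ _ => fpsi.
have [U' [S' [B' [US' UB']]]] := qP _ (at_point pt)
  (fun e => (framed (proj k (pd0 x)) (gens_of pt) e)^T) qpt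
  (fun e => has_valuemx_tr (@genericV_at _ _ _ _ _ _ pt e)).
pose tau v := d (inl v).
pose Y : rep Q k tau := fun a => (B' (inl a))^T.
have yP a : proj k (pd0 x) a *m (U' (inl (tgt a)))^T = (U' (inl (src a)))^T *m Y a.
  by apply: trmx_inj; rewrite /Y -[in RHS]trmx_mul trmxK trmx_mul trmxK; exact:
      (UB' (inl a)).
pose y : hom (proj k (pd0 x)) Y := Defs.Hom (hom_at := fun v => (U' (inl v))^T) yP.
have zy v : (S' (inl v))^T *m y v = 1%:M.
  by rewrite /= -trmx_mul US' trmx1.
have psiy v : psi v *m y v = 0.
  apply: (hom_ext acyclic (f := hom_comp y psi) (h := hom0 _ _)) => u.
  rewrite -[LHS]mul_rowsub_mx -/(gens psi u) gens_free_hom.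
  rewrite [RHS](_ : _ = 0); last by apply/matrixP => ? ?; rewrite !mxE.
  apply: trmx_inj; rewrite trmx_mul trmxK trmx0.
  have := UB' (inr u); rewrite /= => ->.
  have Z : U' (inr u) = 0 by move: (U' (inr u)); rewrite d0 // => Z; apply: flatmx0.
  by rewrite Z mulmx0.
have := unstable_vanishes acyclic zy psiy (fsi (pd_shift x (rel_dim Q tau))) bal.
rewrite (fstab x (rel_dim Q tau) psi) => vanish.
case/eqP: fpsi; apply: vanish.
by move: pos; rewrite euler_framed_op ?subr_gt0 // => v; apply: d0.
Qed.

Lemma support_in_domain (alpha : 'cV[int]_n) : supp_int Q k beta alpha ->
  exists g0 g1 : dimvec n,
  [/\ (euler_mx Q)^T *m alpha = cvec int g0 - cvec int g1,
      (\sum_v g0 v * beta v = \sum_v g1 v * beta v)%N &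
      forall b, general_sub Q k b beta ->
        (\sum_v g0 v * b v <= \sum_v g1 v * b v)%N].
Proof.
case=> f fvirt [x [phi fx0]].
have hz := invariant_hom_zero fvirt fx0.
exists (pd0 x), (pd1 x); split.
- by case: (x) => g0 g1 /= /eqP.
- by case: fvirt => fsi _; apply: semi_invariant_balanced (fsi x) fx0.
move=> b [U [[T UT] [M UM] Usub]].
have /UT[r Tr rM] := UM.
have [q1 q10 q1P] := pull_inj_at acyclic hz.
have [q2 q2E] := open_at_point (pd0 x) (pd1 x) r.
have q20 : q2 != 0.
  apply: contraNneq rM => q20; rewrite -(module_of_coord_point (fun v => 0 :
      'M_(pd1 x v, pdim Q (pd0 x) v)) M).
  by rewrite -q2E q20 /at_point meval0.
have [pt] := nonzero_point (mulf_neq0 q10 q20).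
rewrite at_pointM_neq0 => /andP[q1pt]; rewrite q2E => rpt.
apply: (sub_dim_le (q1P pt q1pt)); apply: Usub; apply/UT.
by exists r.
Qed.

End Converse.

Theorem theorem6p5p11 (k : closedFieldType) (R : realType) (n : nat)
  (Q : quiver n) (hQ : no_oriented_cycles Q) (beta : 'I_n -> nat) :
  supp_int Q k beta =
    ((fun alpha : 'cV[int]_n => map_mx (intr : int -> R) alpha)
       @^-1` domain_D Q k R beta)%classic.
Proof.
apply/seteqP; split=> alpha.
  case/(support_in_domain hQ) => g0 [g1 [alphaE bal sub_le]]; split.
    by rewrite /= (euler_form_presentation R _ alphaE) bal subrr.
  move=> b gb /=; rewrite (euler_form_presentation R _ alphaE).
  by rewrite lerz0 subr_le0 lez_nat; apply: sub_le.
case=> /= form0 sub_le.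
pose w v : int := ((euler_mx Q)^T *m alpha) v ord0.
pose g0 v := if 0 <= w v then `|w v|%N else 0%N.
pose g1 v := if 0 <= w v then 0%N else `|w v|%N.
have alphaE : (euler_mx Q)^T *m alpha = cvec int g0 - cvec int g1.
  apply/matrixP => v j; rewrite !ord1 [RHS]mxE [X in _ = X + _]mxE [X in _ = _
      + X]mxE.
  rewrite [X in _ = _ - X]mxE !natz -/(w v) /g0 /g1.
  by case: ifP => w0; lia.
apply: (domain_in_support hQ alphaE).
- by move=> v; rewrite /g0 /g1; case: ifP; rewrite eqxx ?orbT.
- move: form0; rewrite (euler_form_presentation R _ alphaE) => /eqP.
  by rewrite intr_eq0 subr_eq0 => /eqP[].
move=> b gb; have := sub_le b gb; rewrite /= (euler_form_presentation R _ alphaE).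
by rewrite lerz0 subr_le0 lez_nat.
Qed.
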